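(* Let $R$ be an artin algebra with center $k$, $\mathcal{A}=\mathrm{mod}(R)$, $n\geq 0$, and let $\mathcal{C}\subseteq\mathcal{A}$ be a maximal $n$-orthogonal subcategory. Let $X,Y\in\mathcal{C}$ and write the injective object $\mathbb{S}_{\mathcal{C}}\mathsf{P}_X$ of $\mathcal{H}_{\mathcal{C}}$ as $\mathbb{S}_{\mathcal{C}}\mathsf{P}_X=[X'\to I^{-n-1}\to\cdots\to I^0]$ with $X'\in\mathcal{C}$ in degree $-n-2$ and $I^j$ an injective object of $\mathrm{mod}(R)$ in degree $j$. Then $\underline{\mathrm{Hom}}_{\mathcal{A}}(X,Y)\cong\mathbb{D}\,\mathrm{Ext}^{n+1}_{\mathcal{A}}(Y,X')$.
   Context: $R$ is finite over its center $k$, a commutative artinian ring; $\mathrm{mod}(R)$ is the category of finitely generated left $R$-modules; $\mathbb{D}=\mathrm{Hom}_k(-,E)$ with $E$ the injective hull of $k/\mathrm{rad}(k)$ as $k$-module. $\underline{\mathrm{Hom}}_{\mathcal{A}}(X,Y)$ is $\mathrm{Hom}_{\mathcal{A}}(X,Y)$ modulo the morphisms factoring through a projective module. All subcategories $\mathcal{C}\subseteq\mathcal{A}$ are full, additive, closed under isomorphisms and under direct summands in $\mathcal{A}$. $\mathcal{T}_{\mathcal{C}}=K^-(\mathcal{C})$ (bounded above cochain complexes modulo homotopy) is a full triangulated subcategory of $\mathcal{T}_{\mathcal{A}}=K^-(\mathcal{A})$. $\mathcal{C}$ is $\mathcal{A}$-approximating if every $X\in\mathcal{T}_{\mathcal{A}}$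 has a $\mathcal{C}$-approximation: a quasi-isomorphism $X_{\mathcal{C}}\to X$ with $X_{\mathcal{C}}\in\mathcal{T}_{\mathcal{C}}$ inducing an isomorphism $\mathrm{Hom}_{\mathcal{T}_{\mathcal{C}}}(-,X_{\mathcal{C}})\to\mathrm{Hom}_{\mathcal{T}_{\mathcal{A}}}(-,X)|_{\mathcal{T}_{\mathcal{C}}}$; then $\pi_{\mathcal{C}}X=X_{\mathcal{C}}$ defines a right adjoint $\pi_{\mathcal{C}}:\mathcal{T}_{\mathcal{A}}\to\mathcal{T}_{\mathcal{C}}$ of the inclusion. $\mathcal{C}$ is functorially finite if $\mathcal{C}$ is $\mathcal{A}$-approximating and $\mathcal{C}^{op}$ is $\mathcal{A}^{op}$-approximating. $\mathcal{C}$ is maximal $n$-orthogonal if it is functorially finite, contains all projective and all injective objects of $\mathcal{A}$, and for $X\in\mathcal{A}$: $X\in\mathcal{C}$ if and only if $\mathrm{Ext}^i_{\mathcal{A}}(C,X)=\mathrm{Ext}^i_{\mathcal{A}}(X,C)=0$ for all $C\in\mathcal{C}$ and all $1\leq i\leq n$. $\mathcal{H}_{\mathcal{A}}$ is the abelian category of complexes $[X^{-2}\to X^{-1}\to X^0]$ in $\mathcal{A}$ with no cohomology in negative degrees, morphisms modulo homotopy. $\mathcal{T}^{\leq 0}_{\mathcal{C}}$ is the strictly full subcategory of $\mathcal{T}_{\mathcal{C}}$ generated by complexes with $X^i=0$ for $i>0$; it is the $\leq 0$ part of a $t$-structure with $\mathcal{T}^{\geq 0}_{\mathcal{C}}=\{X\mid\mathrm{Hom}_{\mathcal{T}_{\mathcal{C}}}(\mathcal{T}^{\leq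 0}_{\mathcal{C}}[1],X)=0\}$, and $\mathcal{H}_{\mathcal{C}}$ is its heart, an abelian category; $\pi_{\mathcal{C}}(\mathcal{H}_{\mathcal{A}})=\mathcal{H}_{\mathcal{C}}$. $\mathsf{P}_M$ is the complex with $M$ in degree $0$. For $M\in\mathcal{A}$, $\mathbb{S}_{\mathcal{A}}\mathsf{P}_M$ is the unique injective object of $\mathcal{H}_{\mathcal{A}}$ with $\mathbb{D}\,\mathrm{Hom}_{\mathcal{H}_{\mathcal{A}}}(\mathsf{P}_M,-)\cong\mathrm{Hom}_{\mathcal{H}_{\mathcal{A}}}(-,\mathbb{S}_{\mathcal{A}}\mathsf{P}_M)$, and $\mathbb{S}_{\mathcal{C}}\mathsf{P}_X:=\pi_{\mathcal{C}}(\mathbb{S}_{\mathcal{A}}\mathsf{P}_X)$ for $X\in\mathcal{C}$; it is an injective object of $\mathcal{H}_{\mathcal{C}}$ satisfying $\mathbb{D}\,\mathrm{Hom}_{\mathcal{H}_{\mathcal{C}}}(\mathsf{P}_X,-)\cong\mathrm{Hom}_{\mathcal{H}_{\mathcal{C}}}(-,\mathbb{S}_{\mathcal{C}}\mathsf{P}_X)$. Every injective object of $\mathcal{H}_{\mathcal{C}}$ is isomorphic to a complex $[X'\to I^{-n-1}\to\cdots\to I^0]$ with $X'\in\mathcal{C}$ and $I^j$ injective in $\mathrm{mod}(R)$. *)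

(* Defs.v *)
From HB Require Import structures.
From mathcomp Require Import all_boot all_order all_algebra.
From mathcomp Require Import boolp.

Set Implicit Arguments.
Unset Strict Implicit.
Unset Printing Implicit Defensive.

Import Order.TTheory GRing.Theory Num.Theory.
Local Open Scope ring_scope.
Local Open Scope quotient_scope.

Record submodule (S : nzRingType) (V : lmodType S) := Submodule {
  submod_mem :> V -> bool;
  submodP : submod_closed submod_mem }.

Section QuotientModule.
Variables (S : nzRingType) (V : lmodType S) (W : submodule V).

Fact submod_zmod_closed : zmod_closed (submod_mem W).
Proof.
have [W0 WD] := submodP W; split=> // u v Wu Wv.
by rewrite addrC -scaleN1r; apply: WD.
Qed.

Definition submod_zmod : zmodClosed V :=
  HB.pack (submod_mem W)
    (GRing.isZmodClosed.Build V (submod_mem W) submod_zmod_closed).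

Definition quotMod : Type := Quotient.quot submod_zmod.
HB.instance Definition _ := GRing.Zmodule.on quotMod.

Definition quot_pi (v : V) : quotMod :=
  \pi_(Quotient.quot submod_zmod) v.
Definition quot_repr (x : quotMod) : V := repr x.

Lemma quot_reprK x : quot_pi (quot_repr x) = x.
Proof. exact: reprK. Qed.

Lemma quot_eqP u v : quot_pi u = quot_pi v <-> submod_mem W (u - v).
Proof.
rewrite /quot_pi; split=> [/eqP|Wuv]; first by rewrite -Quotient.idealrBE.
by apply/eqP; rewrite -Quotient.idealrBE.
Qed.

Definition quot_scale (a : S) (x : quotMod) : quotMod :=
  quot_pi (a *: quot_repr x).

Lemma quot_piZ a v : quot_pi (a *: v) = quot_scale a (quot_pi v).
Proof.
apply/quot_eqP; rewrite -scalerBr.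
have [W0 WD] := submodP W; rewrite -[_ *: _]addr0; apply: WD => //.
by apply/quot_eqP; rewrite quot_reprK.
Qed.

Lemma quot_piD u v : quot_pi (u + v) = quot_pi u + quot_pi v.
Proof. exact: raddfD. Qed.

Fact quot_scalerA a b x :
  quot_scale a (quot_scale b x) = quot_scale (a * b) x.
Proof. by rewrite -[x]quot_reprK -!quot_piZ scalerA. Qed.

Fact quot_scale1r : left_id 1 quot_scale.
Proof. by move=> x; rewrite -[x]quot_reprK -!quot_piZ scale1r. Qed.

Fact quot_scalerDr : right_distributive quot_scale +%R.
Proof.
move=> a x y; rewrite -[x]quot_reprK -[y]quot_reprK.
by rewrite -quot_piD -!quot_piZ -quot_piD scalerDr.
Qed.

Fact quot_scalerDl x : {morph quot_scale^~ x : a b / a + b}.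
Proof.
by move=> a b; rewrite -[x]quot_reprK -!quot_piZ scalerDl quot_piD.
Qed.

HB.instance Definition _ := GRing.Zmodule_isLmodule.Build S quotMod
  quot_scalerA quot_scale1r quot_scalerDr quot_scalerDl.

Fact quot_pi_is_linear : linear quot_pi.
Proof. by move=> a u v; rewrite quot_piD quot_piZ. Qed.

HB.instance Definition _ :=
  GRing.isLinear.Build S V quotMod *:%R quot_pi quot_pi_is_linear.

End QuotientModule.

Section SubModule.
Variables (S : nzRingType) (V : lmodType S) (Z B : submodule V).

Definition subMod : Type := {v : V | submod_mem Z v}.
HB.instance Definition _ := SubType.on subMod.
HB.instance Definition _ := Choice.on subMod.

HB.instance Definition _ :=
  GRing.SubChoice_isSubLmodule.Build S V (submod_mem Z) subMod
    (submodP Z).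

Definition restr_mem (v : subMod) : bool := submod_mem B (val v).

Fact restr_closed : submod_closed restr_mem.
Proof.
have [B0 BD] := submodP B.
have val_lin : linear (val : subMod -> V) by move=> a u v; rewrite linearP.
have v0 : val (0 : subMod) = 0 by exact: raddf0.
split=> [|a u v Bu Bv]; rewrite -topredE /= /restr_mem ?v0 //.
by rewrite val_lin; apply: BD.
Qed.

Definition restr_submod : submodule subMod := Submodule restr_closed.

(* Z / (B \cap Z); used when B is contained in Z. *)
Definition subQuot : Type := quotMod restr_submod.
HB.instance Definition _ := GRing.Lmodule.on subQuot.

End SubModule.

Section LinearMaps.
Variables (S : pzRingType) (U V : lmodType S).

Lemma linear_ext (f g : {linear U -> V}) : f =1 g -> f = g.
Proof.
case: f g => [f cf] [g cg] /= /funext fg; subst g; congr GRing.Linear.Pack.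
case: cf cg => [[f1] [f2]] [[g1] [g2]].
by rewrite (Prop_irrelevance f1 g1) (Prop_irrelevance f2 g2).
Qed.

HB.instance Definition _ := gen_eqMixin {linear U -> V}.
HB.instance Definition _ := gen_choiceMixin {linear U -> V}.

Definition lin_zero : {linear U -> V} := \0.
Definition lin_add (f g : {linear U -> V}) : {linear U -> V} := f \+ g.
Definition lin_opp (f : {linear U -> V}) : {linear U -> V} := \- f.

Fact lin_addA : associative lin_add.
Proof. by move=> f g h; apply: linear_ext => x /=; rewrite addrA. Qed.
Fact lin_addC : commutative lin_add.
Proof. by move=> f g; apply: linear_ext => x /=; rewrite addrC. Qed.
Fact lin_add0 : left_id lin_zero lin_add.
Proof. by move=> f; apply: linear_ext => x /=; rewrite add0r. Qed.
Fact lin_addN : left_inverse lin_zero lin_opp lin_add.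
Proof. by move=> f; apply: linear_ext => x /=; rewrite addNr. Qed.

HB.instance Definition _ := GRing.isZmodule.Build {linear U -> V}
  lin_addA lin_addC lin_add0 lin_addN.

End LinearMaps.

(* [HomR X Y] is Hom_R(X, Y), on which the base ring k acts through k -> R. *)
Section Hom.
Variables (k : comNzRingType) (R : algType k).

Definition HomR (X Y : lmodType R) : Type := {linear X -> Y}.

Section HomLmod.
Variables X Y : lmodType R.
HB.instance Definition _ := GRing.Zmodule.on (HomR X Y).

Definition hom_scale_fun (a : k) (f : HomR X Y) : X -> Y :=
  fun x => (a%:A : R) *: f x.

Fact hom_scale_is_linear a f : linear (hom_scale_fun a f).
Proof.
move=> r u v; rewrite /hom_scale_fun linearP scalerDr !scalerA.
by rewrite mulr_algl mulr_algr.
Qed.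

HB.instance Definition _ a f := GRing.isLinear.Build R X Y *:%R
  (hom_scale_fun a f) (hom_scale_is_linear a f).

Definition hom_scale a (f : HomR X Y) : HomR X Y := hom_scale_fun a f.

Fact hom_scalerA a b f : hom_scale a (hom_scale b f) = hom_scale (a * b) f.
Proof.
apply: linear_ext => x /=; rewrite /hom_scale_fun /= /hom_scale_fun.
by rewrite scalerA mulr_algl scalerA.
Qed.
Fact hom_scale1r : left_id 1 hom_scale.
Proof.
by move=> f; apply: linear_ext => x /=; rewrite /hom_scale_fun !scale1r.
Qed.
Fact hom_scalerDr : right_distributive hom_scale +%R.
Proof.
by move=> a f g; apply: linear_ext => x /=; rewrite /hom_scale_fun scalerDr.
Qed.
Fact hom_scalerDl f : {morph hom_scale^~ f : a b / a + b}.
Proof.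
by move=> a b; apply: linear_ext => x /=; rewrite /hom_scale_fun !scalerDl.
Qed.

HB.instance Definition _ := GRing.Zmodule_isLmodule.Build k (HomR X Y)
  hom_scalerA hom_scale1r hom_scalerDr hom_scalerDl.

End HomLmod.
End Hom.

(* [Dual E V] is D V = Hom_k(V, E). *)
Section Dual.
Variables (k : comNzRingType) (E : lmodType k).

Definition Dual (V : lmodType k) : Type := {linear V -> E}.

Section DualLmod.
Variable V : lmodType k.
HB.instance Definition _ := GRing.Zmodule.on (Dual V).

Definition dual_scale (a : k) (f : Dual V) : Dual V := a \*: f.

Fact dual_scalerA a b f :
  dual_scale a (dual_scale b f) = dual_scale (a * b) f.
Proof. by apply: linear_ext => x /=; rewrite scalerA. Qed.
Fact dual_scale1r : left_id 1 dual_scale.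
Proof. by move=> f; apply: linear_ext => x /=; rewrite scale1r. Qed.
Fact dual_scalerDr : right_distributive dual_scale +%R.
Proof. by move=> a f g; apply: linear_ext => x /=; rewrite scalerDr. Qed.
Fact dual_scalerDl f : {morph dual_scale^~ f : a b / a + b}.
Proof. by move=> a b; apply: linear_ext => x /=; rewrite scalerDl. Qed.

HB.instance Definition _ := GRing.Zmodule_isLmodule.Build k (Dual V)
  dual_scalerA dual_scale1r dual_scalerDr dual_scalerDl.
End DualLmod.

Definition dual_map (V V' : lmodType k) (u : {linear V -> V'})
  (xi : Dual V') : Dual V := (xi : {linear V' -> E}) \o u.

End Dual.

Section BaseRing.
Variable k : comNzRingType.

Definition artinian : Prop :=
  forall I : nat -> {pred k^o},
    (forall i, submod_closed (I i)) ->
    (forall i, {subset I i.+1 <= I i}) ->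
  exists N, forall i, (N <= i)%N -> I i =i I N.

(* [idealr_closed] is the library's notion of proper ideal. *)
Definition maximal_ideal (m : {pred k}) : Prop :=
  idealr_closed m /\
  forall J : {pred k}, idealr_closed J -> {subset m <= J} -> {subset J <= m}.

Definition jacobson_mem (a : k^o) : bool :=
  `[< forall m : {pred k}, maximal_ideal m -> a \in m >].

Fact jacobson_closed : submod_closed jacobson_mem.
Proof.
split; first by apply/asboolP => m [[]].
move=> a u v /asboolP hu /asboolP hv; apply/asboolP => m mm.
have [[_ _ mD] _] := mm; apply: mD; [exact: hu | exact: hv].
Qed.

Definition jacobson : submodule k^o := Submodule jacobson_closed.

Definition injective_module (E : lmodType k) : Prop :=
  forall (U V : lmodType k) (f : {linear U -> V}) (g : {linear U -> E}),
    injective f -> exists h : {linear V -> E}, h \o f =1 g.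

Definition injective_hull (V E : lmodType k) : Prop :=
  injective_module E /\
  exists2 iota : {linear V -> E}, injective iota &
    forall W : {pred E}, submod_closed W -> (exists2 x, x \in W & x != 0) ->
      exists2 v, v != 0 & iota v \in W.

End BaseRing.

Definition fingen (S : nzRingType) (V : lmodType S) : Prop :=
  exists (m : nat) (g : 'I_m -> V),
    forall x, exists c : 'I_m -> S, x = \sum_(i < m) c i *: g i.

(* k is artinian and is (identified by a |-> a%:A with) the center of R, and
   R is finite over k. *)
Definition artin_algebra (k : comNzRingType) (R : algType k) : Prop :=
  [/\ artinian k,
      injective (fun a : k => a%:A : R),
      forall z : R, (forall r, r * z = z * r) <-> (exists a : k, z = a%:A)
    & fingen (R : lmodType k)].

Record fgMod (S : nzRingType) := FgMod {
  fgMod_sort :> lmodType S;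
  fgModP : fingen fgMod_sort }.

Section ModR.
Variables (k : comNzRingType) (R : algType k).
Implicit Types (C : fgMod R -> Prop) (M N X Y : fgMod R).

Definition is_zero_mod (V : lmodType R) : Prop := forall x : V, x = 0.

Fact fingen_zero : fingen ('rV[R]_0 : lmodType R).
Proof. by exists 0, (fun=> 0) => x; exists (fun=> 0); rewrite big_ord0 thinmx0. Qed.
Definition zeroMod : fgMod R := FgMod fingen_zero.

Fact fingen_sum M N : fingen ((M * N)%type : lmodType R).
Proof.
have [m [g gP]] := fgModP M; have [n [h hP]] := fgModP N.
exists (m + n)%N, (fun i => match split i with
                            | inl j => (g j, 0) | inr j => (0, h j) end).
move=> [x y]; have [c ->] := gP x; have [d ->] := hP y.
exists (fun i => match split i with inl j => c j | inr j => d j end).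
have sl (i : 'I_m) : split (lshift n i) = inl i by exact: unsplitK (inl i).
have sr (i : 'I_n) : split (rshift m i) = inr i by exact: unsplitK (inr i).
rewrite big_split_ord /=.
under [X in _ = X + _]eq_bigr => i _ do rewrite sl.
under [X in _ = _ + X]eq_bigr => i _ do rewrite sr.
have pair_sum (p : nat) (F : 'I_p -> (M * N)%type) :
    \sum_(i < p) F i = (\sum_(i < p) (F i).1, \sum_(i < p) (F i).2).
  elim: p F => [|p IHp] F; first by rewrite !big_ord0.
  by rewrite !big_ord_recl IHp.
rewrite !pair_sum /=; congr pair; rewrite /=.
  by rewrite [X in _ + X]big1 ?addr0 // => i _; rewrite scaler0.
by rewrite [X in X + _]big1 ?add0r // => i _; rewrite scaler0.
Qed.
Definition sumMod M N : fgMod R := FgMod (fingen_sum M N).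

Definition iso_mod M N : Prop := exists f : {linear M -> N}, bijective f.

(* Epimorphisms (monomorphisms) of mod(R) are the surjective (injective)
   linear maps. *)
Definition projective_obj (P : fgMod R) : Prop :=
  forall (M N : fgMod R) (f : {linear M -> N}) (g : {linear P -> N}),
    (forall y, exists x, f x = y) -> exists h : {linear P -> M}, f \o h =1 g.

Definition injective_obj (I : fgMod R) : Prop :=
  forall (M N : fgMod R) (f : {linear M -> N}) (g : {linear M -> I}),
    injective f -> exists h : {linear N -> I}, h \o f =1 g.

(* Full subcategories of mod(R) are given by their class of objects. *)
Record subcategory C : Prop := {
  subcat_iso : forall M N, iso_mod M N -> C M -> C N;
  subcat_zero : C zeroMod;
  subcat_sum : forall M N, C M -> C N -> C (sumMod M N);
  subcat_summand : forall M N, C (sumMod M N) -> C M }.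

Definition proj_factor_mem X Y (f : HomR X Y) : bool :=
  `[< exists2 P : fgMod R, projective_obj P &
        exists (g : {linear X -> P}) (h : {linear P -> Y}), h \o g =1 f >].

Lemma projective_zero : projective_obj zeroMod.
Proof. by move=> M N f g _; exists \0 => x /=; rewrite thinmx0 !linear0. Qed.

Lemma projective_sum P Q :
  projective_obj P -> projective_obj Q -> projective_obj (sumMod P Q).
Proof.
move=> pP pQ M N f g fsurj.
have gl_lin : linear (fun x : P => g (x, 0)).
  move=> a x y; rewrite -linearP; congr (g _); congr pair => /=.
  by rewrite scaler0 addr0.
have gr_lin : linear (fun y : Q => g (0, y)).
  move=> a x y; rewrite -linearP; congr (g _); congr pair => /=.
  by rewrite scaler0 addr0.
pose gl : {linear P -> N} :=
  HB.pack (fun x : P => g (x, 0)) (GRing.isLinear.Build R P N *:%R _ gl_lin).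
pose gr : {linear Q -> N} :=
  HB.pack (fun y : Q => g (0, y)) (GRing.isLinear.Build R Q N *:%R _ gr_lin).
have [hl hlP] := pP _ _ f gl fsurj; have [hr hrP] := pQ _ _ f gr fsurj.
have h_lin : linear (fun z : sumMod P Q => hl z.1 + hr z.2).
  by move=> a x y /=; rewrite !linearP scalerDr addrACA.
pose h : {linear sumMod P Q -> M} :=
  HB.pack (fun z : sumMod P Q => hl z.1 + hr z.2)
          (GRing.isLinear.Build R (sumMod P Q) M *:%R _ h_lin).
exists h => -[x y]; have /= hx := hlP x; have /= hy := hrP y.
rewrite /= raddfD /= hx hy -raddfD.
by congr (g _); congr pair; rewrite /= ?addr0 ?add0r.
Qed.

Fact proj_factor_closed X Y : submod_closed (@proj_factor_mem X Y).
Proof.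
split.
  apply/asboolP; exists zeroMod; first exact: projective_zero.
  by exists \0, \0.
move=> a f f' /asboolP[P pP [g [h hg]]] /asboolP[P' pP' [g' [h' hg']]].
apply/asboolP; exists (sumMod P P'); first exact: projective_sum.
have g_lin : linear (fun x : X => (g x, g' x) : sumMod P P').
  by move=> b x y; rewrite !linearP.
have h_lin : linear (fun z : sumMod P P' => (a%:A : R) *: h z.1 + h' z.2).
  move=> b x y /=; rewrite !linearP !scalerDr addrACA !scalerA.
  by rewrite mulr_algl mulr_algr.
pose u : {linear X -> sumMod P P'} :=
  HB.pack (fun x : X => (g x, g' x) : sumMod P P')
          (GRing.isLinear.Build R X (sumMod P P') *:%R _ g_lin).
pose v : {linear sumMod P P' -> Y} :=
  HB.pack (fun z : sumMod P P' => (a%:A : R) *: h z.1 + h' z.2)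
          (GRing.isLinear.Build R (sumMod P P') Y *:%R _ h_lin).
exists u, v.
move=> x; have /= hx := hg x; have /= hx' := hg' x.
by rewrite /= /hom_scale_fun hx hx'.
Qed.

Definition proj_factor X Y : submodule (HomR X Y) :=
  Submodule (@proj_factor_closed X Y).

Definition stableHom X Y : Type := quotMod (proj_factor X Y).
HB.instance Definition _ X Y := GRing.Lmodule.on (stableHom X Y).

Record projRes M := ProjRes {
  res_ob :> nat -> fgMod R;
  res_d : forall j, {linear res_ob j.+1 -> res_ob j};
  res_aug : {linear res_ob 0 -> M};
  res_projective : forall j, projective_obj (res_ob j);
  res_aug_surj : forall x, exists y, res_aug y = x;
  res_exact0 : forall x, res_aug x = 0 <-> exists y, x = res_d 0 y;
  res_exactS : forall j x, res_d j x = 0 <-> exists y, x = res_d j.+1 y }.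

Section Ext.
Variables (M : fgMod R) (P : projRes M) (N : fgMod R).

Definition cocycle_mem i (f : HomR (P i) N) : bool :=
  `[< f \o res_d P i =1 \0 >].

Fact cocycle_closed i : submod_closed (@cocycle_mem i).
Proof.
split; first exact/asboolP.
move=> a f g /asboolP hf /asboolP hg; apply/asboolP => x /=.
have /= -> := hg x; have /= := hf x.
by rewrite /hom_scale_fun => ->; rewrite scaler0 addr0.
Qed.

Definition coboundary_mem i : HomR (P i) N -> bool :=
  match i with
  | 0%N => fun f => `[< f =1 \0 >]
  | j.+1 => fun f => `[< exists g : {linear P j -> N}, f =1 g \o res_d P j >]
  end.

Fact coboundary_closed i : submod_closed (@coboundary_mem i).
Proof.
case: i => [|j]; split.
- exact/asboolP.
- move=> a f g /asboolP hf /asboolP hg; apply/asboolP => x /=.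
  by rewrite /hom_scale_fun (hf x) (hg x) scaler0 addr0.
- by apply/asboolP; exists \0.
move=> a f g /asboolP[u hu] /asboolP[v hv]; apply/asboolP.
by exists (a *: (u : HomR _ _) + v) => x /=; rewrite /hom_scale_fun hu hv.
Qed.

(* Ext^i(M, N) = H^i(Hom(P, N)), for a projective resolution P of M in
   mod(R). *)
Definition Ext (i : nat) : Type :=
  subQuot (Submodule (@cocycle_closed i)) (Submodule (@coboundary_closed i)).
HB.instance Definition _ i := GRing.Lmodule.on (Ext i).

End Ext.

(* The vanishing does not depend on the resolution P. *)
Definition Ext_vanish (i : nat) M N : Prop :=
  forall (P : projRes M) (x : Ext P N i), x = 0.

Record complex := Complex {
  cx_ob :> int -> fgMod R;
  cx_d : forall i : int, {linear cx_ob i -> cx_ob (i + 1)};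
  cx_dd : forall (i : int) x, cx_d (i + 1) (cx_d i x) = 0 }.
Implicit Types A B D : complex.

Record chainMap A B := ChainMap {
  cm_map :> forall i : int, {linear A i -> B i};
  cm_comm : forall (i : int) x, cm_map (i + 1) (cx_d A i x) = cx_d B i (cm_map i x) }.

Lemma chainMap_ext A B (f g : chainMap A B) : (forall i, f i =1 g i) -> f = g.
Proof.
case: f g => [f fP] [g gP] /= fg.
have efg : f = g.
  apply: functional_extensionality_dep => i.
  apply: linear_ext; exact: fg.
subst g; by rewrite (Prop_irrelevance fP gP).
Qed.

HB.instance Definition _ A B := gen_eqMixin (chainMap A B).
HB.instance Definition _ A B := gen_choiceMixin (chainMap A B).

Section ChainMapLmod.
Variables A B : complex.
Implicit Types f g : chainMap A B.

Fact cm_zero_comm i x :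
  (\0 : {linear _ -> _}) (cx_d A i x) = cx_d B i ((\0 : {linear A i -> _}) x).
Proof. by rewrite /= linear0. Qed.
Definition cm_zero : chainMap A B := ChainMap cm_zero_comm.

Fact cm_add_comm f g i x :
  (f (i + 1) \+ g (i + 1)) (cx_d A i x) = cx_d B i ((f i \+ g i) x).
Proof. by rewrite /= !cm_comm raddfD. Qed.
Definition cm_add f g : chainMap A B := ChainMap (cm_add_comm f g).

Fact cm_opp_comm f i x :
  (\- f (i + 1)) (cx_d A i x) = cx_d B i ((\- f i) x).
Proof. by rewrite /= cm_comm raddfN. Qed.
Definition cm_opp f : chainMap A B := ChainMap (cm_opp_comm f).

Fact cm_scale_comm (a : k) f i x :
  hom_scale a (f (i + 1)) (cx_d A i x) = cx_d B i (hom_scale a (f i) x).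
Proof. by rewrite /= /hom_scale_fun cm_comm linearZ. Qed.
Definition cm_scale a f : chainMap A B := ChainMap (cm_scale_comm a f).

Fact cm_addA : associative cm_add.
Proof. by move=> f g h; apply: chainMap_ext => i x /=; rewrite addrA. Qed.
Fact cm_addC : commutative cm_add.
Proof. by move=> f g; apply: chainMap_ext => i x /=; rewrite addrC. Qed.
Fact cm_add0 : left_id cm_zero cm_add.
Proof. by move=> f; apply: chainMap_ext => i x /=; rewrite add0r. Qed.
Fact cm_addN : left_inverse cm_zero cm_opp cm_add.
Proof. by move=> f; apply: chainMap_ext => i x /=; rewrite addNr. Qed.
HB.instance Definition _ := GRing.isZmodule.Build (chainMap A B)
  cm_addA cm_addC cm_add0 cm_addN.

Fact cm_scalerA a b f : cm_scale a (cm_scale b f) = cm_scale (a * b) f.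
Proof.
by apply: chainMap_ext => i x /=; rewrite /hom_scale_fun scalerA mulr_algl scalerA.
Qed.
Fact cm_scale1r : left_id 1 cm_scale.
Proof.
by move=> f; apply: chainMap_ext => i x /=; rewrite /hom_scale_fun !scale1r.
Qed.
Fact cm_scalerDr : right_distributive cm_scale +%R.
Proof.
by move=> a f g; apply: chainMap_ext => i x /=; rewrite /hom_scale_fun scalerDr.
Qed.
Fact cm_scalerDl f : {morph cm_scale^~ f : a b / a + b}.
Proof.
by move=> a b; apply: chainMap_ext => i x /=; rewrite /hom_scale_fun !scalerDl.
Qed.
HB.instance Definition _ := GRing.Zmodule_isLmodule.Build k (chainMap A B)
  cm_scalerA cm_scale1r cm_scalerDr cm_scalerDl.

(* f^(i+1) = d^i h^i + h^(i+1) d^(i+1), with h^i : A^(i+1) -> B^i. Every integer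
   is of the form i + 1, so this is the usual condition in all degrees. *)
Definition nullhtpy_mem f : bool :=
  `[< exists h : forall i : int, {linear A (i + 1) -> B i},
        forall (i : int) x,
          f (i + 1) x = cx_d B i (h i x) + h (i + 1) (cx_d A (i + 1) x) >].

Fact nullhtpy_closed : submod_closed nullhtpy_mem.
Proof.
split.
  by apply/asboolP; exists (fun i => \0) => i x /=; rewrite linear0 addr0.
move=> a f g /asboolP[u hu] /asboolP[v hv]; apply/asboolP.
exists (fun i => a *: (u i : HomR _ _) + v i) => i x /=.
rewrite /hom_scale_fun hu hv (linearD (cx_d B i)) (linearZ_LR (cx_d B i)) /=.
by rewrite scalerDr addrACA.
Qed.

Definition nullhtpy : submodule (chainMap A B) := Submodule nullhtpy_closed.

End ChainMapLmod.

(* Morphisms A -> B in the homotopy category. *)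
Definition HomT A B : Type := quotMod (nullhtpy A B).
HB.instance Definition _ A B := GRing.Lmodule.on (HomT A B).

Definition htpy_class A B (f : chainMap A B) : HomT A B := quot_pi _ f.

Definition cm_id A : chainMap A A :=
  @ChainMap A A (fun i => idfun) (fun i x => erefl).

Fact cm_comp_comm A B D (g : chainMap B D) (f : chainMap A B) i x :
  (g (i + 1) \o f (i + 1)) (cx_d A i x) = cx_d D i ((g i \o f i) x).
Proof. by rewrite /= !cm_comm. Qed.
Definition cm_comp A B D (g : chainMap B D) (f : chainMap A B) : chainMap A D :=
  ChainMap (cm_comp_comm g f).

Definition hid A : HomT A A := htpy_class (cm_id A).
Definition hcomp A B D (g : HomT B D) (f : HomT A B) : HomT A D :=
  htpy_class (cm_comp (quot_repr g) (quot_repr f)).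

Lemma hcomp_class A B D (g : chainMap B D) (f : chainMap A B) :
  hcomp (htpy_class g) (htpy_class f) = htpy_class (cm_comp g f).
Proof.
have reprP A' B' (u : chainMap A' B') :
    nullhtpy_mem (quot_repr (htpy_class u) - u).
  by apply: (quot_eqP (nullhtpy A' B') _ _).1; rewrite quot_reprK.
have /asboolP[h hP] := reprP _ _ f; have /asboolP[l lP] := reprP _ _ g.
apply/(quot_eqP (nullhtpy A D))/asboolP.
set f' := quot_repr _ in hP *; set g' := quot_repr _ in lP *.
exists (fun i => (g' i \o h i : HomR _ _) + (l i \o f (i + 1))) => i x /=.
have {hP} hx : f' (i + 1) x =
    cx_d B i (h i x) + h (i + 1) (cx_d A (i + 1) x) + f (i + 1) x.
  by rewrite -hP /= subrK.
have {lP} lx y : g' (i + 1) y =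
    cx_d D i (l i y) + l (i + 1) (cx_d B (i + 1) y) + g (i + 1) y.
  by rewrite -lP /= subrK.
rewrite hx !raddfD /= cm_comm [g' (i + 1) (f _ _)]lx !cm_comm.
by rewrite -[X in X = _]addrA addrK addrACA.
Qed.

Fact hcomp_is_linear A B D (g : HomT B D) : linear (@hcomp A B D g).
Proof.
move=> a u v; rewrite -[g]quot_reprK -[u]quot_reprK -[v]quot_reprK.
rewrite -linearP /= !hcomp_class -[RHS]linearP; congr (htpy_class _).
apply: chainMap_ext => i x /=.
by rewrite /hom_scale_fun raddfD /= linearZ.
Qed.
HB.instance Definition _ A B D g := GRing.isLinear.Build k (HomT A B) (HomT A D)
  *:%R (hcomp g) (@hcomp_is_linear A B D g).

Definition isoT A B : Prop :=
  exists (f : HomT A B) (g : HomT B A), hcomp g f = hid A /\ hcomp f g = hid B.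

(* f induces injective, resp. surjective, maps on cohomology. *)
Definition quasi_iso A B (f : chainMap A B) : Prop :=
  (forall i (x : A (i + 1)) (y : B i), cx_d A (i + 1) x = 0 ->
     f (i + 1) x = cx_d B i y -> exists x' : A i, x = cx_d A i x') /\
  (forall i (y : B (i + 1)), cx_d B (i + 1) y = 0 ->
     exists (x : A (i + 1)) (y' : B i),
       cx_d A (i + 1) x = 0 /\ y = f (i + 1) x + cx_d B i y').

Definition stalk_ob M (i : int) : fgMod R := if i == 0 then M else zeroMod.
Fact stalk_dd M i x :
  (\0 : {linear stalk_ob M (i + 1) -> stalk_ob M (i + 1 + 1)})
    ((\0 : {linear stalk_ob M i -> _}) x) = 0.
Proof. by []. Qed.
(* P_M, with M in degree 0. *)
Definition stalk M : complex := Complex (@stalk_dd M).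

Definition inKminus C A : Prop :=
  (forall i, C (A i)) /\ exists b : int, forall i, b < i -> is_zero_mod (A i).
Definition inKplus C A : Prop :=
  (forall i, C (A i)) /\ exists b : int, forall i, i < b -> is_zero_mod (A i).

Definition modR_all : fgMod R -> Prop := fun=> True.

Definition approximation C A AC (f : chainMap AC A) : Prop :=
  [/\ inKminus C AC, quasi_iso f
    & forall B, inKminus C B ->
        bijective (fun g : HomT B AC => hcomp (htpy_class f) g)].

Definition approximating C : Prop :=
  forall A, inKminus modR_all A ->
  exists AC (f : chainMap AC A), approximation C f.

(* "C^op is A^op-approximating": a bounded above complex in A^op is a bounded
   below complex in A, and all arrows are reversed. *)
Definition coapproximation C A AC (f : chainMap A AC) : Prop :=
  [/\ inKplus C AC, quasi_iso f
    & forall B, inKplus C B ->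
        bijective (fun g : HomT AC B => hcomp g (htpy_class f))].

Definition coapproximating C : Prop :=
  forall A, inKplus modR_all A ->
  exists AC (f : chainMap A AC), coapproximation C f.

Definition functorially_finite C : Prop := approximating C /\ coapproximating C.

Record maximal_orthogonal (n : nat) C : Prop := {
  mo_functorially_finite : functorially_finite C;
  mo_projective : forall P, projective_obj P -> C P;
  mo_injective : forall I, injective_obj I -> C I;
  mo_orthogonal : forall X, C X <->
    forall Y, C Y -> forall i, (1 <= i <= n)%N ->
      Ext_vanish i Y X /\ Ext_vanish i X Y }.

Definition inHA A : Prop :=
  (forall i : int, ~~ (-2 <= i <= 0) -> is_zero_mod (A i)) /\
  (forall (i : int) (x : A (i + 1)), i + 1 < 0 -> cx_d A (i + 1) x = 0 ->
     exists y, x = cx_d A i y).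

Definition monoHA A B (f : HomT A B) : Prop :=
  forall D, inHA D -> injective (fun g : HomT D A => hcomp f g).

Definition injectiveHA S : Prop :=
  inHA S /\
  forall A B (f : HomT A B) (g : HomT A S), inHA A -> inHA B -> monoHA f ->
    exists h : HomT B S, hcomp h f = g.

(* S is the injective object of H_A with a natural isomorphism
   phi : D Hom(P_M, -) -> Hom(-, S) of functors on H_A. *)
Definition is_SA (E : lmodType k) M S : Prop :=
  injectiveHA S /\
  exists phi : forall A, {linear Dual E (HomT (stalk M) A) -> HomT A S},
    (forall A, inHA A -> bijective (phi A)) /\
    (forall A B (u : HomT A B) (xi : Dual E (HomT (stalk M) B)),
       inHA A -> inHA B ->
       phi A (dual_map (hcomp u) xi) = hcomp (phi B xi) u).

(* T is S_C P_X = pi_C (S_A P_X). *)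
Definition is_SC (E : lmodType k) C X T : Prop :=
  exists S (f : chainMap T S), is_SA E X S /\ approximation C f.

(* Z = [X' -> I^(-n-1) -> ... -> I^0], with X' = Z^(-n-2) in C. *)
Record injective_shape (n : nat) C (Z : complex) : Prop := {
  shape_gt0 : forall i : int, 0 < i -> is_zero_mod (Z i);
  shape_lt : forall i : int, i < - n.+2%:Z -> is_zero_mod (Z i);
  shape_C : C (Z (- n.+2%:Z));
  shape_inj : forall i : int, - n.+1%:Z <= i <= 0 -> injective_obj (Z i) }.

End ModR.

(* Main.v *)
(* Write Z = [X' -> I^(-n-1) -> ... -> I^0], and let P_0 -> Y be onto with P_0
   projective. As Z is homotopy equivalent to T, which is quasi-isomorphic to an
   object of H_A, Z is exact in negative degrees. Comparing Z with a projective
   resolution of Y identifies Ext^(n+1)(Y, X') with the kernel of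
     Hom(P_Y, Z) -> Hom(P_(P_0), Z).
   Since Hom(P_M, Z) = Hom(P_M, S_A P_X) = D Hom(X, M) naturally for M in C, this
   kernel is the dual of the cokernel of Hom(X, P_0) -> Hom(X, Y), which is the
   stable Hom module. The isomorphism is then dualized: the stable Hom module is
   reflexive, by Matlis duality over the artinian ring k. *)

Require Import Defs.
From HB Require Import structures.
From mathcomp Require Import all_boot all_order all_algebra.
From mathcomp Require Import ring boolp classical_sets.

Set Implicit Arguments.
Unset Strict Implicit.
Unset Printing Implicit Defensive.

Import Order.TTheory GRing.Theory Num.Theory.
Local Open Scope ring_scope.

(** * Submodules and ideals *)

(** The duality is given as Hom(-, S_A P_X) = D Hom(P_X, -), so what can be computed directly is the
    dual of stable Hom; exchanging the two sides costs a bidual. [E] is only known as an injective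
    hull of k / rad k, and k may have several maximal ideals: that [E] is a cogenerator whose
    endomorphisms are all homotheties has to be derived, the latter by induction along a filtration
    of k by ideals. The degree n+1 of Ext is a matter of counting. With Y placed below its
    resolution, P_(n+1) stands n+2 steps above Y, just as X' stands n+2 steps above Z^0. A cocycle
    P_(n+1) -> X' descends to a map Y -> Z^0 by extending into the n+2 injectives I^(-n-1), ...,
    I^0. A map Y -> Z^0 climbs back by lifting from projectives, except for the first step P_0 ->
    Z^(-1), because Y itself need not be projective. That this step exists is exactly the vanishing
    in Hom(P_(P_0), Z), which is why a kernel appears. *)

Lemma inj_surj_bij (T U : Type) (f : T -> U) :
  injective f -> (forall y, exists x, f x = y) -> bijective f.
Proof.
move=> f_inj f_surj; have [g gK] := choice f_surj.
by exists g => // x; apply: f_inj; rewrite gK.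
Qed.

Section LinearExtension.
Variables (S : nzRingType).
Implicit Types U V W : lmodType S.

Definition mk_linear U V (f : U -> V) (f_lin : linear f) : {linear U -> V} :=
  HB.pack f (GRing.isLinear.Build S U V *:%R f f_lin).

Definition subm V (A : V -> Prop) : Prop :=
  A 0 /\ forall a u v, A u -> A v -> A (a *: u + v).

Fact subm_closed V (A : V -> Prop) : subm A -> submod_closed (fun v => `[< A v >]).
Proof.
move=> [A0 AD]; split; first exact/asboolP.
by move=> a u v /asboolP Au /asboolP Av; apply/asboolP/AD.
Qed.

Definition subm_submodule V (A : V -> Prop) (hA : subm A) : submodule V :=
  Submodule (subm_closed hA).

Lemma quot_pi_eq0 V (A : submodule V) v : quot_pi A v = 0 <-> submod_mem A v.
Proof. by rewrite -[in X in X <-> _](linear0 (quot_pi A)) quot_eqP subr0. Qed.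

Lemma subm_pi_eq0 V (A : V -> Prop) (hA : subm A) v :
  quot_pi (subm_submodule hA) v = 0 <-> A v.
Proof. by rewrite quot_pi_eq0; split=> /asboolP. Qed.

Lemma subm_scale V (A : V -> Prop) a u : subm A -> A u -> A (a *: u).
Proof. by move=> [A0 AD] Au; rewrite -[_ *: _]addr0; apply: AD. Qed.

Lemma subm_sub V (A : V -> Prop) u v : subm A -> A u -> A v -> A (u - v).
Proof. by move=> [A0 AD] Au Av; rewrite addrC -scaleN1r; apply: AD. Qed.

Lemma subm_add V (A : V -> Prop) u v : subm A -> A u -> A v -> A (u + v).
Proof. by move=> [A0 AD] Au Av; rewrite -[u]scale1r; apply: AD. Qed.

Lemma subm_ker U V (f : {linear U -> V}) : subm (fun u => f u = 0).
Proof.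
by split=> [|a u v fu fv]; rewrite ?linear0 // linearP fu fv scaler0 addr0.
Qed.

Lemma subm_im U V (f : {linear U -> V}) : subm (fun v => exists u, v = f u).
Proof.
split=> [|a _ _ [u ->] [v ->]]; first by exists 0; rewrite linear0.
by exists (a *: u + v); rewrite linearP.
Qed.

Fact scale_at_linear V (v : V) : linear (fun a : S^o => (a : S) *: v).
Proof. by move=> a b c; rewrite scalerDl scalerA. Qed.

Definition scale_at V (v : V) : {linear S^o -> V} := mk_linear (scale_at_linear v).

Lemma quot_lift V U (A : submodule V) (q : {linear V -> U}) :
  (forall v, submod_mem A v -> q v = 0) ->
  exists q' : {linear quotMod A -> U}, forall v, q' (quot_pi A v) = q v.
Proof.
move=> qA; pose f (x : quotMod A) := q (quot_repr x).
have fpi v : f (quot_pi A v) = q v.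
  apply/eqP; rewrite -subr_eq0 -raddfB; apply/eqP/qA.
  by apply/(quot_eqP A); rewrite quot_reprK.
have f_lin : linear f.
  move=> a x y; rewrite -[x]quot_reprK -[y]quot_reprK -linearP !fpi.
  by rewrite linearP.
by exists (mk_linear f_lin).
Qed.

(** Injectivity is stated for monomorphisms only. Dividing by ker p turns p into one, so that q can
    be extended along an arbitrary p whose kernel it kills. *)
Lemma ker_factor U V W (p : {linear U -> V}) (q : {linear U -> W}) :
  (forall u, p u = 0 -> q u = 0) ->
  exists (A : submodule U) (p' : {linear quotMod A -> V}) (q' : {linear quotMod A -> W}),
    [/\ injective p', forall u, p' (quot_pi A u) = p u &
        forall u, q' (quot_pi A u) = q u].
Proof.
move=> pq; exists (subm_submodule (subm_ker p)).
have [|p' p'E] := @quot_lift _ _ (subm_submodule (subm_ker p)) p.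
  by move=> u /asboolP.
have [|q' q'E] := @quot_lift _ _ (subm_submodule (subm_ker p)) q.
  by move=> u /asboolP/pq.
exists p', q'; split=> // x y.
rewrite -[x]quot_reprK -[y]quot_reprK !p'E => pxy.
by apply/quot_eqP/asboolP; rewrite raddfB /= pxy subrr.
Qed.

Lemma surj_lift U V W (p : {linear U -> V}) (q : {linear U -> W}) :
  (forall y, exists x, p x = y) -> (forall x, p x = 0 -> q x = 0) ->
  exists h : {linear V -> W}, forall x, h (p x) = q x.
Proof.
move=> p_surj pq; pose s y := sval (cid (p_surj y)).
have sK y : p (s y) = y by rewrite /s; case: cid.
have sE x : q (s (p x)) = q x.
  by apply/eqP; rewrite -subr_eq0 -raddfB; apply/eqP/pq; rewrite raddfB /= sK subrr.
have h_lin : linear (fun y => q (s y)).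
  move=> a x y; have := sE (a *: s x + s y).
  by rewrite linearP !sK linearP.
by exists (mk_linear h_lin) => x /=.
Qed.

End LinearExtension.

Section Ideals.
Variable k : comNzRingType.
Implicit Types I J m : k^o -> Prop.

Lemma subm_mulr I (a b : k) : subm I -> I a -> I (a * b).
Proof. by rewrite mulrC; apply: subm_scale. Qed.

Lemma subm_mull I (a b : k) : subm I -> I b -> I (a * b).
Proof. exact: subm_scale. Qed.

Definition maxid m : Prop :=
  [/\ subm m, ~ m 1 &
    forall J, subm J -> ~ J 1 -> (forall x, m x -> J x) -> forall x, J x -> m x].

(** Otherwise m + k a would be a proper ideal, and maximality would put a into m. *)
Lemma maxid_inv m a : maxid m -> ~ m a -> exists c : k, m (1 - c * a).
Proof.
move=> [mS m1 mmax] ma; apply: contrapT => no_c; apply: ma.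
apply: (mmax (fun x => exists c : k, m (x - c * a))).
- split=> [|b u v [c mu] [d mv]]; first by exists 0; rewrite mul0r subr0; case: mS.
  exists (b * c + d); have [_ mD] := mS.
  have := mD b _ _ mu mv; congr m.
  by rewrite /GRing.scale /=; ring.
- exact: no_c.
- by move=> x mx; exists 0; rewrite mul0r subr0.
- by exists 1; rewrite mul1r subrr; case: mS.
Qed.

Lemma maxid_prime m (a b : k) : maxid m -> m (a * b) -> m a \/ m b.
Proof.
move=> mm mab; have [ma|/(maxid_inv mm)[c mc]] := pselect (m a); [by left|right].
have [mS _ _] := mm.
have := subm_add mS (subm_scale b mS mc) (subm_scale c mS mab).
congr m; rewrite /GRing.scale /=; ring.
Qed.

Lemma maxid_exists I : subm I -> ~ I 1 ->
  exists m, maxid m /\ forall x, I x -> m x.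
Proof.
move=> IS I1.
pose Q (A : set k) := subm (A : k^o -> Prop) /\ ~ A 1 /\ (I `<=` A)%classic.
pose Q' (A : set k) := Q A \/ A = set0.
have [|A [QA Amax]] := @Zorn_bigcup k Q'.
  move=> F FQ Ftot.
  have [[A [FA QA]]|noA] := pselect (exists A, F A /\ Q A); last first.
    right; rewrite -subset0 => x [A FA Ax].
    have [QA|A0] := FQ _ FA; last by rewrite A0 in Ax.
    by case: noA; exists A.
  left; split; last first.
    split=> [[B FB B1]|x Ix]; last by exists A => //; have [_ [_ IA]] := QA; apply: IA.
    have [QB|B0] := FQ _ FB; last by rewrite B0 in B1.
    by have [_ [nB1 _]] := QB.
  split; first by exists A => //; have [[A0 _] _] := QA.
  move=> a u v [B FB Bu] [D FD Dv].
  have QB : Q B by have [//|B0] := FQ _ FB; rewrite B0 in Bu.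
  have QD : Q D by have [//|D0] := FQ _ FD; rewrite D0 in Dv.
  have [BD|DB] := Ftot _ _ FB FD.
    by exists D => //; have [[_ DD] _] := QD; apply: DD => //; apply: BD.
  by exists B => //; have [[_ BB] _] := QB; apply: BB => //; apply: DB.
have {QA}QA : Q A.
  have [//|A0] := QA; exfalso; apply: (Amax I); last by left; split; last split.
  rewrite A0; split=> [x []|I0].
  by apply: (I0 0); case: IS.
have [AS [A1 IA]] := QA.
exists A; split=> //; split=> // J JS J1 AJ x Jx; apply: contrapT => Ax.
apply: (Amax J); first by split=> [y /AJ|/(_ x Jx)].
by left; split=> //; split=> // y /IA /AJ.
Qed.

Lemma jacobson_maxid x : submod_mem (jacobson k) x <-> forall m, maxid m -> m x.
Proof.
split=> [/asboolP Jx m [mS m1 mmax]|Jx].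
  suff: x \in (fun y => `[< m y >] : bool) by rewrite -topredE /= => /asboolP.
  apply: Jx; split.
    split; first by apply/asboolP; case: mS.
      by apply/asboolP.
    move=> a u v /asboolP mu /asboolP mv; apply/asboolP; case: mS => _.
    by apply.
  move=> J [J0 J1 JD] mJ y Jy; apply/asboolP.
  apply: (mmax (fun y => y \in J)) => //; first exact/negP.
  by move=> z mz; apply: mJ; apply/asboolP.
apply/asboolP => m [[m0 m1 mD] mmax].
apply: (Jx (fun y => y \in m)); split.
- by split=> // a u v; apply: mD.
- exact/negP.
move=> J [J0 JD] J1 mJ y Jy.
apply: (mmax (fun y => `[< J y >])); last exact/asboolP.
  split; [exact/asboolP| exact/asboolP|].
  by move=> a u v /asboolP Ju /asboolP Jv; apply/asboolP/JD.
by move=> z mz; apply/asboolP/mJ.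
Qed.

Hypothesis artin_k : artinian k.

(** Without a minimal member, choice would produce a strictly descending sequence in [G], against
    the chain condition. *)
Lemma artinian_min (G : (k^o -> Prop) -> Prop) :
  (forall I, G I -> subm I) -> (exists I, G I) ->
  exists2 I, G I & forall I', G I' -> (forall x, I' x -> I x) ->
    forall x, I x -> I' x.
Proof.
move=> GS [I0 GI0]; apply: contrapT => no_min.
have next (I : {I | G I}) : exists J : {I | G I},
    (forall x, sval J x -> sval I x) /\ exists x, sval I x /\ ~ sval J x.
  case: I => I GI /=; apply: contrapT => noJ; apply: no_min.
  exists I => // J GJ JI x Ix.
  apply: contrapT => nJx; apply: noJ; exists (exist _ J GJ); split=> //.
  by exists x.
have [step stepP] := choice next.
pose s n : {I | G I} := iter n step (exist _ I0 GI0).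
have [||N sN] := artin_k (I := fun n x => `[< sval (s n) x >]).
- by move=> n; apply: subm_closed; apply: GS; case: (s n).
- move=> n x /asboolP; rewrite /s iterS => sx; apply/asboolP.
  exact: (stepP _).1 sx.
have [_ [x [sx nsx]]] := stepP (s N); apply: nsx.
suff /asboolP : x \in (fun y => `[< sval (s N.+1) y >]) by [].
by rewrite (sN N.+1) //; apply/asboolP.
Qed.

End Ideals.

(** * Matlis duality *)

Section InjectiveModules.
Variables (k : comNzRingType) (E : lmodType k).
Implicit Types U V W : lmodType k.
Hypothesis inj_E : injective_module E.

Lemma inj_extend U V (p : {linear U -> V}) (q : {linear U -> E}) :
  (forall u, p u = 0 -> q u = 0) ->
  exists h : {linear V -> E}, forall u, h (p u) = q u.
Proof.
move=> /ker_factor[A [p' [q' [p'_inj p'E q'E]]]].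
have [h hE] := inj_E q' p'_inj.
by exists h => u; rewrite -p'E -q'E -hE.
Qed.

Definition cogenerator : Prop :=
  forall V (v : V), v != 0 -> exists xi : {linear V -> E}, xi v != 0.

Lemma cogenerator_separates V (A : V -> Prop) (v : V) :
  cogenerator -> subm A -> ~ A v ->
  exists2 xi : {linear V -> E}, (forall u, A u -> xi u = 0) & xi v != 0.
Proof.
move=> cogE hA Av.
have [|xi xi_v] := cogE _ (quot_pi (subm_submodule hA) v).
  by apply/eqP => /subm_pi_eq0.
exists (xi \o quot_pi (subm_submodule hA)) => //= u Au.
by have /subm_pi_eq0 -> := Au; rewrite linear0.
Qed.

Definition ffun_single (I : finType) V (i : I) (v : V) : {ffun I -> V} :=
  [ffun j => if j == i then v else 0].

Fact ffun_single_linear (I : finType) V (i : I) : linear (@ffun_single I V i).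
Proof.
move=> a u v; apply/ffunP => j; rewrite !ffunE.
by case: eqP => // _; rewrite scaler0 addr0.
Qed.

Lemma ffun_linear_sum (I : finType) V W (h : {linear {ffun I -> V} -> W}) :
  exists hs : I -> {linear V -> W}, forall y, h y = \sum_i hs i (y i).
Proof.
exists (fun i => h \o mk_linear (@ffun_single_linear I V i)) => y /=.
rewrite -linear_sum; congr (h _); apply/ffunP => j.
rewrite sum_ffunE (bigD1 j) //= ffunE eqxx big1 ?addr0 // => i nij.
by rewrite ffunE eq_sym (negPf nij).
Qed.

Definition spans (I : finType) V (g : I -> V) : Prop :=
  forall v, exists c : I -> k, v = \sum_i c i *: g i.

Lemma spans_ffun (I J : finType) V (g : I -> V) : spans g ->
  spans (fun ij : J * I => ffun_single ij.1 (g ij.2)).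
Proof.
move=> gP y; have [c cE] := choice (fun j => gP (y j)).
exists (fun ij => c ij.1 ij.2).
rewrite -(pair_bigA _ (fun j i => c j i *: ffun_single j (g i))) /=.
apply/ffunP => j; rewrite sum_ffunE (bigD1 j) //= [X in _ + X]big1 ?addr0.
  by rewrite cE sum_ffunE; apply: eq_bigr => i _; rewrite !ffunE eqxx.
move=> j' nj; rewrite sum_ffunE big1 // => i _.
by rewrite !ffunE eq_sym (negPf nj) scaler0.
Qed.

End InjectiveModules.

Section Matlis.
Variables (k : comNzRingType) (E : lmodType k).
Hypotheses (artin_k : artinian k)
  (hull_E : injective_hull (quotMod (jacobson k)) E).

Let inj_E : injective_module E := hull_E.1.

Definition kills (I : k^o -> Prop) (e : E) := forall a, I a -> (a : k) *: e = 0.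

Lemma jac_pi_eq0 x : quot_pi (jacobson k) x = 0 <-> forall m, maxid m -> m x.
Proof. by rewrite quot_pi_eq0 jacobson_maxid. Qed.

(** The elements killed by m all come from k / rad k, where they form a line over the field k /
    m. *)
Lemma socle_line m (x y : E) : maxid m -> kills m x -> kills m y -> x != 0 ->
  exists a : k, y = a *: x.
Proof.
move=> mm mx my x0; have [_ [iota iota_inj iota_ess]] := hull_E.
have [mS _ _] := mm.
have iota0 z : iota z = 0 -> z = 0 by rewrite -{1}(linear0 iota) => /iota_inj.
(* By essentiality some multiple a z is a nonzero element of the image; a is invertible modulo m,
   which kills z, so z is in the image too. *)
have lift z : kills m z -> z != 0 -> exists al, z = iota (quot_pi _ al).
  move=> mz z0; have := iota_ess (fun w => `[< exists a : k, w = a *: z >]).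
  case=> [||v v0 /asboolP[a iv]].
  - apply: subm_closed; split=> [|b _ _ [c ->] [d ->]].
      by exists 0; rewrite scale0r.
    by exists (b * c + d); rewrite scalerDl scalerA.
  - by exists z => //; apply/asboolP; exists 1; rewrite scale1r.
  have ma : ~ m a.
    by move=> /mz az; rewrite az in iv; rewrite (iota0 _ iv) eqxx in v0.
  have [c mc] := maxid_inv mm ma; exists (quot_repr (c *: v)).
  rewrite quot_reprK linearZ /= iv scalerA; apply/eqP.
  by rewrite -subr_eq0 -{1}[z]scale1r -scalerBl mz.
have [y0|y0] := eqVneq y 0; first by exists 0; rewrite scale0r.
have [al xE] := lift _ mx x0; have [be yE] := lift _ my y0.
have mul_jac z ga : kills m z -> z = iota (quot_pi _ ga) ->
    forall mu, m mu -> forall m', maxid m' -> m' (mu *: ga).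
  move=> mz zE mu /mz; rewrite zE -linearZ /= -linearZ /=.
  by move=> /iota0 /jac_pi_eq0.
(* If al were in m, then al * al would lie in every maximal ideal; these are prime, so al would be
   in rad k and x would be 0. *)
have mal : ~ m al.
  move=> mal; move: x0; rewrite xE.
  suff -> : quot_pi (jacobson k) al = 0 by rewrite linear0 eqxx.
  apply/jac_pi_eq0 => m' mm'.
  by have [] := maxid_prime mm' (mul_jac _ _ mx xE _ mal _ mm').
have [c mc] := maxid_inv mm mal.
exists ((be : k) * c); rewrite xE yE -linearZ /= -linearZ /=; congr (iota _).
apply/eqP; rewrite -subr_eq0 -raddfB; apply/eqP/jac_pi_eq0 => m' mm'.
have := mul_jac _ _ my yE _ mc _ mm'; congr m'.
by rewrite /GRing.scale /=; ring.
Qed.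

(* The finite intersections of maximal ideals not contained in m. *)
Inductive avoid (m : k^o -> Prop) : (k^o -> Prop) -> Prop :=
| avoidT : avoid m (fun=> True)
| avoidI A m' : avoid m A -> maxid m' -> (exists x, m' x /\ ~ m x) ->
    avoid m (fun x => A x /\ m' x).

(** A minimal intersection A as in [avoid] lies in every maximal ideal other than m, but by
    primality not in m. For a in A outside m, m a lies in rad k, so the class of a is nonzero and
    killed by m. *)
Lemma socle_neq0 m : maxid m -> exists2 e, e != 0 & kills m e.
Proof.
move=> mm; have [_ [iota iota_inj _]] := hull_E; have [mS m1 mmax] := mm.
have avS A : avoid m A -> subm A.
  elim=> // {}A m' _ [A0 AD] [[m'0 m'D] _ _] _; split=> // a u v [Au mu] [Av mv].
  by split; [apply: AD|apply: m'D].
have avm A : avoid m A -> exists x, A x /\ ~ m x.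
  elim=> [|{}A m' avA [a [Aa ma]] [m'S _ _] [b [mb nmb]]]; first by exists 1.
  exists ((b : k) * a); split; last by case/(maxid_prime mm).
  split; first exact: subm_scale (avS _ avA) Aa.
  exact: subm_mulr.
have [A avA Amin] := artinian_min artin_k avS (ex_intro _ _ (avoidT m)).
have [a [Aa ma]] := avm _ avA.
exists (iota (quot_pi _ a)).
  apply/eqP; rewrite -(linear0 iota) => /iota_inj /jac_pi_eq0 Ja.
  exact: ma (Ja _ mm).
move=> b mb; rewrite -linearZ -(linear0 iota); congr (iota _).
rewrite /= -linearZ; apply/jac_pi_eq0 => m' mm'; have [m'S m'1 m'max] := mm'.
have [m'm|] := pselect (forall x, m' x -> m x).
  suff mm'E : forall x, m x -> m' x by exact: subm_mulr (mm'E _ mb).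
  by apply: m'max.
move=> /existsNP[x /not_implyP m'x].
apply: subm_scale => //.
by have [] := Amin _ (avoidI avA mm' (ex_intro _ _ m'x)) (fun x h => h.1) a Aa.
Qed.

(** The annihilator of v lies in a maximal ideal m, so sending v to a nonzero element killed by m is
    well defined on k v; injectivity extends it to V. *)
Lemma hull_cogenerator : cogenerator E.
Proof.
move=> V v v0.
have annS := subm_ker (scale_at v).
have [|m [mm annm]] := maxid_exists annS.
  by rewrite /= scale1r; apply/eqP.
have [e e0 me] := socle_neq0 mm.
have [|h hE] := @inj_extend _ _ inj_E _ _ (scale_at v) (scale_at e).
  by move=> a /annm/me.
by exists h; have /= := hE 1; rewrite !scale1r => ->.
Qed.

(** Induction leads from I = k, where this is trivial, to I = 0, where it concerns all of [E]. *)
Definition homothetic (I : k^o -> Prop) : Prop :=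
  forall th : {linear E -> E}, exists a : k, forall e, kills I e -> th e = a *: e.

Lemma homothetic_socle m (th : {linear E -> E}) : maxid m ->
  exists a : k, forall e, kills m e -> th e = a *: e.
Proof.
move=> mm; have [x x0 mx] := socle_neq0 mm.
have thm e : kills m e -> kills m (th e).
  by move=> me a ma; rewrite -linearZ /= me ?linear0.
have [a tx] := socle_line mm mx (thm _ mx) x0.
exists a => e /(socle_line mm mx)/(_ x0)[b ->].
by rewrite linearZ /= tx !scalerA mulrC.
Qed.

(* For e_1, ..., e_r killed by I', if (th e_i)_i is not of the form (b e_i)_i with
   b in I, it is separated from these by eta = (eta_i)_i. All b e_i and th e_i lie
   in the socle at m, where eta_i is a scalar h_i; so \sum_i h_i e_i is killed by I,
   hence by th, a contradiction. *)
Lemma homothetic_step (I I' m : k^o -> Prop) :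
  subm I -> subm I' -> maxid m -> (forall x, I' x -> I x) ->
  (forall (a b : k), m a -> I b -> I' (a * b)) ->
  homothetic I -> homothetic I'.
Proof.
move=> IS I'S mm I'I mI homI th0.
have [a0 a0P] := homI th0.
have th_lin : linear (fun e : E => th0 e - a0 *: e).
  move=> a u v; rewrite linearP scalerDr opprD addrACA scalerBr.
  by rewrite !scalerA mulrC.
pose th := mk_linear th_lin.
have th0I e : kills I e -> th e = 0 by move=> /a0P /= ->; rewrite subrr.
suff [b Ib bP] : exists2 b : k, I b & forall e, kills I' e -> th e = b *: e.
  by exists (a0 + b) => e /bP /=; rewrite scalerDl => <-; rewrite addrC subrK.
have socI (e : E) (b : k) : kills I' e -> I b -> kills m (b *: e).
  by move=> I'e Ib a ma; rewrite scalerA; apply/I'e/mI.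
have th_soc e : kills I' e -> kills m (th e).
  move=> I'e a ma; rewrite -linearZ; apply: th0I => b Ib.
  by rewrite scalerA mulrC; apply/I'e/mI.
have fin (s : seq E) : (forall e, e \in s -> kills I' e) ->
    exists2 b : k, I b & forall e, e \in s -> th e = b *: e.
  move=> sP; pose r := size s; pose es (i : 'I_r) := s`_i.
  have esP i : kills I' (es i) by apply/sP/mem_nth.
  pose A (y : {ffun 'I_r -> E}) := exists2 b : k, I b & forall i, y i = b *: es i.
  have AS : subm A.
    split; first by exists 0 => [|i]; [case: IS|rewrite ffunE scale0r].
    move=> a u v [b Ib ub] [c Ic vc]; exists (a * b + c); first by case: IS => _; apply.
    by move=> i; rewrite !ffunE ub vc scalerDl scalerA.
  have [[b Ib bP]|nA] := pselect (A [ffun i => th (es i)]).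
    exists b => // e es_e; have ie : (index e s < r)%N by rewrite index_mem.
    by have := bP (Ordinal ie); rewrite ffunE /es /= nth_index.
  have [eta etaA] := cogenerator_separates hull_cogenerator AS nA.
  have [etas etasE] := ffun_linear_sum eta; case/eqP; rewrite etasE.
  have [h hP] := choice (fun i => homothetic_socle (etas i) mm).
  have sum0 : kills I (\sum_i h i *: es i).
    move=> b Ib; rewrite scaler_sumr.
    have Ab : A [ffun i => b *: es i] by exists b => // i; rewrite ffunE.
    apply: (etrans _ (etaA _ Ab)); rewrite etasE; apply: eq_bigr => i _.
    by rewrite ffunE scalerA mulrC -scalerA -hP //; apply: socI.
  apply: (etrans _ (th0I _ sum0)); rewrite linear_sum; apply: eq_bigr => i _.
  by rewrite ffunE hP ?linearZ //; apply: th_soc.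
(* The scalar given by [fin] depends on s. When the ideal of those b in I that kill s is minimal,
   adjoining an element e changes the scalar only by something that also kills e, so one scalar
   serves all e. *)
pose G (J : k^o -> Prop) := exists2 s : seq E, (forall e, e \in s -> kills I' e) &
  J = (fun b => I b /\ forall e, e \in s -> (b : k) *: e = 0).
have GS J : G J -> subm J.
  move=> [s _ ->]; split.
    by split; [case: IS|move=> e _; rewrite scale0r].
  move=> a u v [Iu us] [Iv vs]; split; first by case: IS => _; apply.
  by move=> e es; rewrite scalerDl -scalerA us // vs // scaler0 addr0.
have [|J [s sP JE] Jmin] := artinian_min artin_k GS.
  by eexists; exists [::].
have [b Ib bP] := fin s sP; exists b => // e I'e.
have esP f : f \in e :: s -> kills I' f by rewrite inE => /predU1P[->|/sP].
have {fin}[c Ic cP] := fin _ esP.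
have GJ' : G (fun b => I b /\ forall f, f \in e :: s -> (b : k) *: f = 0).
  by exists (e :: s).
have Jcb : J (c - b).
  rewrite JE; split=> [|f fs]; first exact: subm_sub IS Ic Ib.
  by rewrite scalerBl -bP // -cP ?subrr // inE fs orbT.
have [|_ /(_ e (mem_head _ _))] := Jmin _ GJ' _ _ Jcb.
  by rewrite JE => x [Ix xs]; split=> // f fs; apply: xs; rewrite inE fs orbT.
rewrite scalerBl -cP ?mem_head // => /eqP.
by rewrite subr_eq0 => /eqP.
Qed.

(* The ideals I for which k / I has a finite filtration whose factors are killed by
   maximal ideals. *)
Inductive maxfil : (k^o -> Prop) -> Prop :=
| maxfilT : maxfil (fun=> True)
| maxfilS I I' m : maxfil I -> subm I' -> maxid m -> (forall x, I' x -> I x) ->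
    (forall a b : k, m a -> I b -> I' (a * b)) -> maxfil I'.

Lemma maxfil_subm I : maxfil I -> subm I.
Proof. by case=> //; split. Qed.

Lemma maxfil_homothetic I : maxfil I -> homothetic I.
Proof.
elim=> [th|{}I I' m fI homI I'S mm I'I mI].
  by exists 0 => e /(_ 1 Logic.I); rewrite scale1r => ->; rewrite linear0 scaler0.
exact: homothetic_step (maxfil_subm fI) I'S mm I'I mI homI.
Qed.

(** The product ideal as the least ideal containing the products, so that inclusions are tested on
    products and no finite sums occur. *)
Definition prod_id (I J : k^o -> Prop) (x : k^o) : Prop :=
  forall W : k^o -> Prop, subm W -> (forall a b : k, I a -> J b -> W (a * b)) -> W x.

Lemma prod_id_subm I J : subm (prod_id I J).
Proof.
split=> [W [] //|a u v Iu Iv W WS WIJ].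
by have [_] := WS; apply; [apply: Iu|apply: Iv].
Qed.

Lemma prod_id_mul I J (a b : k) : I a -> J b -> prod_id I J (a * b).
Proof. by move=> Ia Jb W _; apply. Qed.

Lemma prod_id_subr I J x : subm J -> prod_id I J x -> J x.
Proof. by move=> JS; apply=> // a b _; apply: subm_mull. Qed.

(** Multiplying the filtration of k / J by I gives one of I / I J, which continues that of k / I. *)
Lemma maxfil_prod I J : maxfil I -> maxfil J -> maxfil (prod_id I J).
Proof.
move=> fI; have IS := maxfil_subm fI.
elim=> [|{}J J' m fJ fIJ J'S mm J'J mJ].
  suff -> : prod_id I (fun=> True) = I by [].
  apply/funext => x; apply/propext; split.
    by apply=> // a b Ia _; apply: subm_mulr.
  by move=> Ix; rewrite -[x]mulr1; apply: prod_id_mul.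
apply: maxfilS fIJ (prod_id_subm _ _) mm _ _.
  move=> x IJx; apply: (IJx (prod_id I J) (prod_id_subm _ _)).
  by move=> a b Ia /J'J; apply: prod_id_mul.
move=> a x ma IJx; apply: (IJx (fun x => prod_id I J' (a * x))).
  have [P0 PD] := prod_id_subm I J'; split=> [|b u v]; first by rewrite mulr0.
  by rewrite mulrDr mulrCA; apply: PD.
by move=> b c Ib Jc; rewrite mulrCA; apply: prod_id_mul => //; apply: mJ.
Qed.

Lemma maxfil_prodl I m : maxid m -> maxfil I -> maxfil (prod_id m I).
Proof.
move=> mm fI; apply: (maxfilS fI (prod_id_subm m I) mm _ (@prod_id_mul m I)) => x.
exact: prod_id_subr (maxfil_subm fI).
Qed.

(* A minimal such ideal I is idempotent and contained in every maximal ideal. If it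
   is nonzero, an ideal L minimal for I L <> 0 is generated by some b in I b, so
   that b = 0 because 1 - c is invertible for c in I. *)
Lemma maxfil0 : maxfil (fun x => x = 0).
Proof.
have [I fI Imin] := artinian_min artin_k maxfil_subm (ex_intro _ _ maxfilT).
have IS := maxfil_subm fI.
suff I0 x : I x -> x = 0.
  suff <- : I = (fun x => x = 0) by [].
  apply/funext => x; apply/propext; split=> [/I0 //|->]; by case: IS.
have II y : I y -> prod_id I I y.
  by apply: Imin (maxfil_prod fI fI) _ _ => {}y; apply: prod_id_subr.
have Im m : maxid m -> forall y, I y -> m y.
  move=> mm y /(Imin _ (maxfil_prodl mm fI) (fun x => prod_id_subr (x := x) IS)).
  by have [mS _ _] := mm; apply=> // a b ma _; apply: subm_mulr.
move=> Ix; apply/eqP/negPn/negP => /eqP x0.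
pose G (L : k^o -> Prop) :=
  subm L /\ exists a b : k, [/\ I a, L b & a * b <> 0].
have zeroS (b : k) : subm (fun a : k^o => a * b = 0).
  split=> [|a u v u0 v0]; first by rewrite mul0r.
  by rewrite mulrDl -mulrA u0 v0 mulr0 addr0.
have [||L [LS [a [b [Ia Lb ab0]]]] Lmin] := artinian_min artin_k (G := G).
- by move=> ? [].
- exists I; split=> //; apply: contrapT => nG; apply: x0.
  rewrite -[x]mulr1; apply: (II x Ix _ (zeroS 1)) => a b Ia Ib.
  by apply: contrapT => ab; apply: nG; exists a, b; rewrite mulr1 in ab.
have [||c Ic bE] := Lmin (fun z => exists2 c : k, I c & z = c * b) _ _ b Lb.
- split.
    split=> [|d _ _ [u Iu ->] [v Iv ->]]; first by exists 0; [case: IS|rewrite mul0r].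
    exists (d * u + v); first by case: IS => _; apply.
    by rewrite mulrDl -mulrA.
  apply: contrapT => nG; apply: ab0; apply: (II a Ia _ (zeroS b)) => c d Ic Id.
  apply: contrapT => cd; apply: nG; exists c, (d * b); split=> //; first by exists d.
  by rewrite mulrA.
- by move=> _ [c Ic ->]; apply: subm_mull.
have dS : subm (fun z : k^o => exists d : k, z = d * (1 - c)).
  split=> [|d _ _ [u ->] [v ->]]; first by exists 0; rewrite mul0r.
  by exists (d * u + v); rewrite mulrDl -mulrA.
have [[d dE]|nd] := pselect (exists d : k, 1 = d * (1 - c)).
  by apply: ab0; rewrite -[b]mul1r dE -mulrA mulrBl mul1r -bE subrr !mulr0.
have [m [mm dm]] := maxid_exists dS nd; have [mS m1 _] := mm; apply: m1.
rewrite -(subrK (c : k^o) 1); apply: subm_add => //; last exact: Im.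
by apply: dm; exists 1; rewrite mul1r.
Qed.

Lemma hull_homothety (th : {linear E -> E}) : exists a : k, forall e, th e = a *: e.
Proof.
have [a aP] := maxfil_homothetic maxfil0 th.
by exists a => e; apply: aP => _ ->; rewrite scale0r.
Qed.

(** Only surjectivity of the map from V to its bidual: injectivity follows from
    [hull_cogenerator]. *)
Definition reflexive_mod (V : lmodType k) : Prop :=
  forall chi : {linear Dual E V -> E}, exists v, forall xi, chi xi = xi v.

(** Evaluation at the generators embeds the dual of V into a power of [E]. By injectivity chi
    extends to this power, where its components are homotheties a_i, so chi is evaluation at the sum
    of the a_i g_i. *)
Lemma reflexive_span (I : finType) (V : lmodType k) (g : I -> V) :
  spans g -> reflexive_mod V.
Proof.
move=> gP chi.
have ev_lin : linear (fun xi : Dual E V => [ffun i => xi (g i)]).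
  by move=> a x y; apply/ffunP => i; rewrite !ffunE.
have [|h hE] := @inj_extend _ _ inj_E _ _ (mk_linear ev_lin) chi.
  move=> xi /= xi0; suff -> : xi = 0 by rewrite linear0.
  apply: linear_ext => v; have [c ->] := gP v.
  rewrite linear_sum big1 // => i _; rewrite linearZ /=.
  by have /ffunP/(_ i) := xi0; rewrite !ffunE => ->; rewrite scaler0.
have [hs hsE] := ffun_linear_sum h.
have [a aP] := choice (fun i => hull_homothety (hs i)).
exists (\sum_i a i *: g i) => xi; rewrite -hE hsE linear_sum.
by apply: eq_bigr => i _; rewrite /= ffunE aP linearZ.
Qed.

(** The vector of V representing chi lies in the image of i, or else a functional vanishing on the
    image would separate it. This spares proving submodules of finite k-modules finite. *)
Lemma reflexive_sub (U V : lmodType k) (i : {linear U -> V}) :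
  injective i -> reflexive_mod V -> reflexive_mod U.
Proof.
move=> i_inj reflV chi.
have res_lin : linear (fun xi : Dual E V => dual_map i xi).
  by move=> a x y; apply: linear_ext.
have [v vP] := reflV (chi \o mk_linear res_lin).
have [u uv] : exists u, v = i u.
  apply: contrapT => nv.
  have [xi xi0] := cogenerator_separates hull_cogenerator (subm_im i) nv.
  case/eqP; rewrite -(vP xi) /=; apply: (etrans _ (linear0 chi)); congr (chi _).
  by apply: linear_ext => u /=; apply: xi0; exists u.
exists u => xi.
have [|h hE] := @inj_extend _ _ inj_E _ _ i xi.
  by move=> w; rewrite -{1}(linear0 i) => /i_inj ->; rewrite linear0.
rewrite -hE -uv -(vP h) /=; congr (chi _).
by apply: linear_ext => w /=.
Qed.

Lemma reflexive_quot (U V : lmodType k) (p : {linear U -> V}) :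
  (forall v, exists u, p u = v) -> reflexive_mod U -> reflexive_mod V.
Proof.
move=> p_surj reflU chi.
have pull_lin : linear (fun xi : Dual E V => dual_map p xi).
  by move=> a x y; apply: linear_ext.
have [|h hE] := @inj_extend _ _ inj_E _ _ (mk_linear pull_lin) chi.
  move=> xi /= xi0; suff -> : xi = 0 by rewrite linear0.
  apply: linear_ext => v; have [u <-] := p_surj v.
  by have := congr1 (fun f : Dual E U => f u) xi0.
have [u uP] := reflU h.
by exists (p u) => xi; rewrite -hE uP.
Qed.

(** [phi] is the map from V to its bidual followed by the transpose of [L]. *)
Lemma reflexive_dualize (U V : lmodType k) (L : {linear U -> Dual E V}) :
  reflexive_mod V -> bijective L ->
  exists phi : {linear V -> Dual E U}, bijective phi.
Proof.
move=> reflV [M LK MK].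
have at_lin v : linear (fun u => L u v) by move=> a x y; rewrite linearP.
have phi_lin : linear (fun v => mk_linear (at_lin v) : Dual E U).
  by move=> a x y; apply: linear_ext => u /=; rewrite linearP.
have M_lin : linear M by move=> a x y; rewrite -{1}[x]MK -{1}[y]MK -linearP LK.
exists (mk_linear phi_lin); apply: inj_surj_bij => [v w vw|eta].
  apply/eqP; rewrite -subr_eq0; apply/negPn/negP => /hull_cogenerator[xi].
  rewrite raddfB subr_eq0 -[xi]MK => /eqP; apply.
  exact: (congr1 (fun f : Dual E U => f (M xi)) vw).
have [v vP] := reflV (eta \o mk_linear M_lin).
by exists v; apply: linear_ext => u /=; rewrite -vP /= LK.
Qed.

End Matlis.

(** * Reflexivity of stable Hom modules *)

(** Serves to build an isomorphism whose values depend on choices of lifts: by linearity,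
    independence of the choices and injectivity need checking only at 0. *)
Lemma linear_relation_bij (k : nzRingType) (U V : lmodType k) (Rel : U -> V -> Prop) :
  (forall a u u' v v', Rel u v -> Rel u' v' -> Rel (a *: u + u') (a *: v + v')) ->
  (forall u, exists v, Rel u v) -> (forall v, exists u, Rel u v) ->
  (forall v, Rel 0 v -> v = 0) -> (forall u, Rel u 0 -> u = 0) ->
  exists L : {linear U -> V}, bijective L.
Proof.
move=> RelD tot_l tot_r Rel0l Rel0r.
have RelB u u' v v' : Rel u v -> Rel u' v' -> Rel (u - u') (v - v').
  move=> uv uv'; rewrite addrC [v - _]addrC -scaleN1r -[- v']scaleN1r.
  exact: RelD.
have [L LP] := choice tot_l.
have L_uniq u v : Rel u v -> L u = v.
  move=> uv; apply/eqP; rewrite -subr_eq0; apply/eqP/Rel0l.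
  by rewrite -(subrr u); apply: RelB.
have L_lin : linear L by move=> a u v; apply/L_uniq/RelD.
exists (mk_linear L_lin); apply: inj_surj_bij => [u v uv|v].
  apply/eqP; rewrite -subr_eq0; apply/eqP/Rel0r.
  by rewrite -(subrr (L u)) {2}[L u]uv; apply: RelB.
by have [u /L_uniq] := tot_r v; exists u.
Qed.

Lemma lin_sumE (S : pzRingType) (U V : lmodType S) (I : finType)
    (F : I -> {linear U -> V}) x : (\sum_i F i) x = \sum_i F i x.
Proof. exact: (big_morph (fun f : {linear U -> V} => f x)). Qed.

Section HomReflexive.
Variables (k : comNzRingType) (R : algType k) (E : lmodType k).
Hypotheses (artin_R : artin_algebra R)
  (hull_E : injective_hull (quotMod (jacobson k)) E).
Variables X Y : fgMod R.

(** [Y] is given as an R-module only; Hom_R(R, Y) serves as its underlying k-module. *)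
Definition at_gen (y : Y) : HomR (R^o : lmodType R) Y := scale_at y.

Lemma spans_Hom_regular :
  exists (I : finType) (g : I -> HomR (R^o : lmodType R) Y), spans g.
Proof.
have [_ _ _ [p [r rP]]] := artin_R; have [q [y yP]] := fgModP Y.
exists ('I_q * 'I_p)%type, (fun ij => at_gen (r ij.2 *: y ij.1)) => f.
have [c cE] := yP (f 1); have [a aE] := choice (fun i => rP (c i)).
exists (fun ij => a ij.1 ij.2); apply: linear_ext => x.
have -> : x = x *: (1 : R^o) by rewrite /GRing.scale /= mulr1.
rewrite !linearZ; congr (_ *: _); rewrite cE.
rewrite -(pair_bigA _ (fun i j => a i j *: at_gen (r j *: y i))) /= lin_sumE.
apply: eq_bigr => i _; rewrite lin_sumE aE scaler_suml; apply: eq_bigr => j _.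
by rewrite /= /hom_scale_fun /= scale1r scalerA mulr_algl.
Qed.

(** Stable Hom is a quotient of Hom(X, Y), which embeds into a finite power of Hom_R(R, Y) by the
    values on generators of X. *)
Lemma stableHom_reflexive : reflexive_mod E (stableHom X Y).
Proof.
have [artin_k _ _ _] := artin_R.
apply: (reflexive_quot hull_E (p := quot_pi (proj_factor X Y))).
  by move=> v; exists (quot_repr v); apply: quot_reprK.
have [m [x xP]] := fgModP X.
have [I [g gP]] := spans_Hom_regular.
have res_lin : linear (fun f : HomR X Y => [ffun i : 'I_m => at_gen (f (x i))]).
  move=> a f f'; apply/ffunP => i; rewrite !ffunE; apply: linear_ext => r /=.
  by rewrite /hom_scale_fun /= scalerDr !scalerA mulr_algl mulr_algr.
apply: (reflexive_sub artin_k hull_E (i := mk_linear res_lin)).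
  move=> f f' /ffunP ff'; apply: linear_ext => z; have [c ->] := xP z.
  rewrite !linear_sum; apply: eq_bigr => i _; rewrite !linearZ; congr (_ *: _).
  have := ff' i; rewrite !ffunE => /(congr1 (fun h : HomR _ _ => h 1)) /=.
  by rewrite !scale1r.
exact: (reflexive_span artin_k hull_E (spans_ffun gP)).
Qed.

End HomReflexive.

(** * Comparing a projective and an injective resolution *)

Section Lifting.
Variables (k : comNzRingType) (R : algType k).
Implicit Types M N P I : fgMod R.

Lemma fingen_quot M (A : submodule M) : fingen (quotMod A : lmodType R).
Proof.
have [m [g gP]] := fgModP M; exists m, (fun i => quot_pi A (g i)) => x.
have [c cE] := gP (quot_repr x); exists c.
rewrite -[x]quot_reprK cE linear_sum; apply: eq_bigr => i _.
by rewrite linearZ.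
Qed.

Lemma injective_obj_extend M N I (p : {linear M -> N}) (q : {linear M -> I}) :
  injective_obj I -> (forall x, p x = 0 -> q x = 0) ->
  exists h : {linear N -> I}, forall x, h (p x) = q x.
Proof.
move=> injI /ker_factor[A [p' [q' [p'_inj p'E q'E]]]].
have [h hE] := injI (FgMod (fingen_quot A)) _ p' q' p'_inj.
by exists h => u; rewrite -p'E -q'E -hE.
Qed.

(** Projectivity is tested inside mod(R), so the image of p is represented by M / ker p, which is
    visibly finitely generated. *)
Lemma projective_obj_lift P M N (p : {linear M -> N}) (q : {linear P -> N}) :
  projective_obj P -> (forall x, exists y, q x = p y) ->
  exists h : {linear P -> M}, forall x, p (h x) = q x.
Proof.
move=> projP qp; pose A := subm_submodule (subm_ker p).
pose MA := FgMod (fingen_quot A).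
pose pi : {linear M -> MA} := quot_pi A.
have pi_surj y : exists x, pi x = y by exists (quot_repr y); apply: quot_reprK.
have piE x y : p x = p y -> pi x = pi y.
  by move=> pxy; apply/quot_eqP/asboolP; rewrite raddfB /= pxy subrr.
have piE' x y : pi x = pi y -> p x = p y.
  move=> /quot_eqP/asboolP/eqP; rewrite raddfB subr_eq0.
  by move=> /eqP.
have [s sE] := choice qp.
have q'_lin : linear (fun x => pi (s x)).
  by move=> a x y; rewrite -linearP; apply: piE; rewrite -sE !linearP -!sE.
have [h hE] := projP _ _ pi (mk_linear q'_lin) pi_surj.
by exists h => x; rewrite sE; apply/piE'/hE.
Qed.

End Lifting.

Section Ladder.
Variables (k : comNzRingType) (R : algType k).
Variables (Q W : nat -> fgMod R).
Variables (dQ : forall j, {linear Q j.+1 -> Q j}) (dW : forall j, {linear W j.+1 -> W j}).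
Variable n : nat.
Hypotheses (Q_proj : forall j, projective_obj (Q j.+1))
  (Q_surj : forall y, exists x, dQ 0 x = y)
  (Q_exact : forall j x, dQ j x = 0 <-> exists y, x = dQ j.+1 y).
Hypotheses (dWdW : forall j x, dW j (dW j.+1 x) = 0)
  (W_exact : forall j x, dW j x = 0 -> exists y, x = dW j.+1 y)
  (W_inj : forall j, (j <= n)%N -> injective_obj (W j)).

(* [ladder f g]: f : Q_m -> W_m extends downwards to maps Q_j -> W_j, j <= m, that
   commute with the differentials and end with g. [null f]: f is homotopic to 0 in
   degree m; for m = 0 the term through dQ is absent. *)
Fixpoint ladder m : {linear Q m -> W m} -> {linear Q 0 -> W 0} -> Prop :=
  match m with
  | 0 => fun f g => f =1 g
  | m'.+1 => fun f g => exists2 f' : {linear Q m' -> W m'},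
      (forall x, dW m' (f x) = f' (dQ m' x)) & ladder f' g
  end.

Definition null m : {linear Q m -> W m} -> Prop :=
  match m with
  | 0 => fun f => exists v : {linear Q 0 -> W 1}, forall x, f x = dW 0 (v x)
  | m'.+1 => fun f =>
      exists (u : {linear Q m' -> W m'.+1}) (v : {linear Q m'.+1 -> W m'.+2}),
      forall x, f x = u (dQ m' x) + dW m'.+1 (v x)
  end.

(** Exactly what lets a ladder be continued downwards: dW f must vanish on the kernel of the next
    dQ, which is the image of the previous one. *)
Definition weak_cocycle m : {linear Q m -> W m} -> Prop :=
  match m with
  | 0 => fun f => True
  | m'.+1 => fun f => forall x, dW m' (f (dQ m'.+1 x)) = 0
  end.

Lemma dQdQ j x : dQ j (dQ j.+1 x) = 0.
Proof. by apply/Q_exact; exists x. Qed.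

Lemma ladder_linear m a (f f' : {linear Q m -> W m}) g g' :
  ladder f g -> ladder f' g' ->
  ladder (a *: (f : HomR _ _) + f') (a *: (g : HomR _ _) + g').
Proof.
elim: m f f' => [|m IHm] f f' /=.
  by move=> fg fg' x /=; rewrite /hom_scale_fun fg fg'.
move=> [h fh hg] [h' fh' hg']; exists (a *: (h : HomR _ _) + h'); last exact: IHm.
by move=> x /=; rewrite linearD /hom_scale_fun linearZ /= fh fh'.
Qed.

Lemma ladder_total_l m (f : {linear Q m -> W m}) : (m <= n.+1)%N ->
  weak_cocycle f -> exists g, ladder f g.
Proof.
elim: m f => [|m IHm] f le_mn cf; first by exists f.
have [|f' f'E] := @injective_obj_extend _ _ _ _ _ (dQ m) (dW m \o f) (W_inj le_mn).
  by move=> x /Q_exact[y ->] /=; apply: cf.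
have [|g f'g] := IHm f' (ltnW le_mn); last by exists g, f'.
case: m {IHm le_mn} f f' cf f'E => // m f f' cf f'E x.
by rewrite /= f'E /= dWdW.
Qed.

(** W is not assumed exact at W 0, so the first step up cannot be found by lifting and is supplied
    by f1. *)
Lemma ladder_total_r (g : {linear Q 0 -> W 0}) (f1 : {linear Q 1 -> W 1}) m :
  (forall x, dW 0 (f1 x) = g (dQ 0 x)) ->
  exists2 f : {linear Q m.+1 -> W m.+1}, weak_cocycle f & ladder f g.
Proof.
move=> f1g; elim: m => [|m [f' cf' f'g]].
  exists f1 => [x|]; first by rewrite f1g dQdQ linear0.
  by exists g.
have [|f fE] := @projective_obj_lift _ _ _ _ _ (dW m.+1) (f' \o dQ m.+1) (@Q_proj _).
  by move=> x; apply/W_exact/cf'.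
exists f; last by exists f'.
by move=> x; rewrite fE /= dQdQ linear0.
Qed.

Lemma ladder_bottom m (f : {linear Q m.+1 -> W m.+1}) g : ladder f g ->
  exists f1 : {linear Q 1 -> W 1}, forall x, dW 0 (f1 x) = g (dQ 0 x).
Proof.
elim: m f => [|m IHm] f [f' ff' f'g]; last exact: IHm f'g.
by exists f => x; rewrite ff' f'g.
Qed.

(** If f = u dQ + dW v, then f' - dW u vanishes on the image of dQ and extends along the next dQ by
    injectivity: u takes over the role of v one degree lower. In degree 0, surjectivity of [dQ 0]
    gives f' = dW u. *)
Lemma ladder_null_l m (f : {linear Q m -> W m}) g : (m <= n.+1)%N ->
  ladder f g -> null f -> null g.
Proof.
elim: m f => [|m IHm] f le_mn /=.
  by move=> fg [v vE]; exists v => x; rewrite -fg vE.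
move=> [f' ff' f'g] [u [v fE]]; apply: (IHm f' (ltnW le_mn) f'g).
have f'E x : f' (dQ m x) = dW m (u (dQ m x)).
  by rewrite -ff' fE linearD dWdW addr0.
case: m {IHm} f f' le_mn u v ff' f'g fE f'E => [|m] f f' le_mn u v ff' f'g fE f'E.
  by exists u => y; have [x <-] := Q_surj y.
have [|u' u'E] := @injective_obj_extend _ _ _ _ _ (dQ m)
    ((f' : HomR _ _) - (dW m.+1 \o u : {linear _ -> _})) (@W_inj m.+1 le_mn).
  by move=> x /Q_exact[y ->] /=; rewrite f'E subrr.
by exists u', u => x; rewrite u'E /= subrK.
Qed.

(** In the other direction, if f' is null through u, then f - u dQ is killed by dW and lifts by
    exactness and projectivity. *)
Lemma ladder_null_r m (f : {linear Q m -> W m}) g :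
  ladder f g -> null g -> null f.
Proof.
elim: m f => [|m IHm] f /=.
  by move=> fg [v vE]; exists v => x; rewrite fg vE.
move=> [f' ff' f'g] /(IHm _ f'g) nf'.
have [u uE] : exists u : {linear Q m -> W m.+1}, forall x, f' (dQ m x) = dW m (u (dQ m x)).
  case: m {IHm} f f' ff' f'g nf' => [|m] f f' ff' f'g [u] => [uE|[v uE]].
    by exists u => x.
  by exists v => x; rewrite uE dQdQ linear0 add0r.
have [|v vE] := @projective_obj_lift _ _ _ _ _ (dW m.+1)
    ((f : HomR _ _) - (u \o dQ m : {linear _ -> _})) (@Q_proj _).
  by move=> x; apply: W_exact; rewrite /= linearB ff' uE subrr.
by exists u, v => x; rewrite vE /= addrC subrK.
Qed.

End Ladder.

(** * Morphisms from stalk complexes *)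

Section Homotopy.
Variables (k : comNzRingType) (R : algType k).
Implicit Types (A B D : complex R) (M N L : fgMod R).

Lemma zeroMod_eq0 (x : zeroMod R) : x = 0.
Proof. exact: thinmx0. Qed.

Lemma stalk_eq0 M i (x : stalk_ob M i) : i != 0 -> x = 0.
Proof.
by case: i x => [[|j]|j] x // _; apply: zeroMod_eq0.
Qed.

Lemma htpy_class_linear A B : linear (@htpy_class k R A B).
Proof. exact: linearP. Qed.

Lemma htpy_class_eq0 A B (f : chainMap A B) :
  htpy_class f = 0 <-> nullhtpy_mem f.
Proof. exact: quot_pi_eq0. Qed.

Lemma htpy_classK A B (h : HomT A B) : htpy_class (quot_repr h) = h.
Proof. exact: quot_reprK. Qed.

Lemma hcompA A B D F (h : HomT D F) (g : HomT B D) (f : HomT A B) :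
  hcomp h (hcomp g f) = hcomp (hcomp h g) f.
Proof.
rewrite -[h]htpy_classK -[g]htpy_classK -[f]htpy_classK !hcomp_class.
by congr htpy_class; apply: chainMap_ext.
Qed.

Lemma hcomp1 A B (f : HomT A B) : hcomp (hid B) f = f.
Proof.
rewrite -[f]htpy_classK hcomp_class.
by congr htpy_class; apply: chainMap_ext.
Qed.

Section FromStalk.
Variables (M : fgMod R) (B : complex R).
Hypothesis dB0 : forall y : B 0, cx_d B 0 y = 0.

Definition stalk_map_fun (g : {linear M -> B 0}) (i : int) :
    {linear stalk M i -> B i} :=
  match i with
  | Posz 0 => g
  | Posz j.+1 => \0
  | Negz j => \0
  end.

Fact stalk_map_comm g i x :
  stalk_map_fun g (i + 1) (cx_d (stalk M) i x) = cx_d B i (stalk_map_fun g i x).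
Proof.
rewrite /= linear0; case: i x => [[|j]|j] x /=; rewrite ?linear0 //.
Qed.

Definition stalk_map g : chainMap (stalk M) B := ChainMap (stalk_map_comm g).
Definition stalk_hom (g : HomR M (B 0)) : HomT (stalk M) B := htpy_class (stalk_map g).

Fact stalk_hom_linear : linear stalk_hom.
Proof.
move=> a g g'; rewrite /stalk_hom -htpy_class_linear; congr htpy_class.
apply: chainMap_ext => -[[|j]|j] x //=.
  by rewrite /hom_scale_fun /= scaler0 addr0.
by rewrite /hom_scale_fun /= scaler0 addr0.
Qed.

Lemma stalk_hom_surj h : exists g, stalk_hom g = h.
Proof.
exists (quot_repr h 0); rewrite -[RHS]htpy_classK; congr htpy_class.
apply: chainMap_ext => i x.
have [i0|i0] := eqVneq i 0; first by move: x; rewrite i0.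
by rewrite (stalk_eq0 x i0) !linear0.
Qed.

Lemma stalk_hom_eq0 g :
  stalk_hom g = 0 <-> exists v : {linear M -> B (- 1)}, forall x, g x = cx_d B (- 1) (v x).
Proof.
rewrite htpy_class_eq0; split=> [/asboolP[h hP]|[v vE]].
  by exists (h (- 1)) => x; have := hP (- 1) x; rewrite /= linear0 addr0.
apply/asboolP.
exists (fun i => match i return {linear stalk_ob M (i + 1) -> B i} with
                 | Negz 0 => v | _ => \0 end) => i x /=.
have [i1|i1] := eqVneq i (- 1); first by move: x; rewrite i1 => x; rewrite linear0 addr0 -vE.
have i1' : i + 1 != 0 by rewrite addr_eq0.
by rewrite (stalk_eq0 x i1') !linear0 addr0.
Qed.

End FromStalk.

Definition stalk_d0 M (y : stalk M 0) : cx_d (stalk M) 0 y = 0 := erefl.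

Definition stalk_pure M N (u : HomR M N) : HomT (stalk M) (stalk N) :=
  stalk_hom (@stalk_d0 N) u.

Lemma stalk_pure_eq0 M N (u : HomR M N) : stalk_pure u = 0 -> u = 0.
Proof. by case/stalk_hom_eq0 => v vE; apply: linear_ext => x; rewrite vE. Qed.

Lemma hcomp_stalk_hom M N B (dB0 : forall y : B 0, cx_d B 0 y = 0)
    (g : {linear N -> B 0}) (u : {linear M -> N}) :
  hcomp (stalk_hom dB0 g) (stalk_pure u) = stalk_hom dB0 (g \o u).
Proof.
rewrite hcomp_class; congr htpy_class; apply: chainMap_ext.
by move=> -[[|j]|j] x /=.
Qed.

Lemma hcomp_stalk_pure M N L (g : {linear N -> L}) (u : {linear M -> N}) :
  hcomp (stalk_pure g) (stalk_pure u) = stalk_pure (g \o u).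
Proof. exact: hcomp_stalk_hom. Qed.

Lemma stalk_inHA M : inHA (stalk M).
Proof.
split=> [i i0 x|i x i0 _]; first by apply: stalk_eq0; apply: contraNneq i0 => ->.
by exists 0; rewrite linear0; apply: stalk_eq0; rewrite lt_eqF.
Qed.

Lemma stalk_inKminus (C : fgMod R -> Prop) M :
  subcategory C -> C M -> inKminus C (stalk M).
Proof.
move=> subC CM; split=> [i|].
  by rewrite /= /stalk_ob; case: eqP => // _; apply: subcat_zero.
by exists 0 => i i0 x; apply: stalk_eq0; rewrite gt_eqF.
Qed.

(** The exactness clause of [inHA] without its bound on degrees, since Z reaches down to degree
    -n-2. *)
Definition neg_exact A := forall (i : int) (x : A (i + 1)),
  i + 1 < 0 -> cx_d A (i + 1) x = 0 -> exists y, x = cx_d A i y.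

Lemma quasi_iso_neg_exact A B (f : chainMap A B) :
  quasi_iso f -> neg_exact B -> neg_exact A.
Proof.
move=> [f_inj _] exB i x i0 dx.
have [|y fx] := exB i (f (i + 1) x) i0; first by rewrite -cm_comm dx linear0.
exact: f_inj fx.
Qed.

Lemma isoT_neg_exact A B : isoT A B -> neg_exact B -> neg_exact A.
Proof.
move=> [a [b [ba _]]] exB i x i0 dx; move: ba.
rewrite -[a]htpy_classK -[b]htpy_classK hcomp_class.
move: (quot_repr a) (quot_repr b) => {}a {}b /quot_eqP/asboolP[h /(_ i x)].
rewrite /= dx linear0 addr0.
have [|y ->] := exB i (a (i + 1) x) i0; first by rewrite -cm_comm dx linear0.
rewrite cm_comm => /eqP; rewrite subr_eq => /eqP xE.
by exists (b i y - h i x); rewrite linearB xE addrAC subrr add0r.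
Qed.

End Homotopy.

(** * Reindexing a complex by homological degree *)

Section NatIndexing.
Variables (k : comNzRingType) (R : algType k) (Z : complex R).

(** The degrees [- (j.+1)%:Z + 1] and [- j%:Z] are equal but not convertible for a variable j. *)
Definition cx_cast (i j : int) (e : i = j) : {linear Z i -> Z j} :=
  match e in _ = j return {linear Z i -> Z j} with erefl => idfun end.

Lemma cx_cast_id i (e : i = i) x : cx_cast e x = x.
Proof. by rewrite (Prop_irrelevance e erefl). Qed.

Lemma cx_castK i j (e : i = j) x : cx_cast e (cx_cast (esym e) x) = x.
Proof. by case: j / e x. Qed.

Lemma cx_cast_eq0 i j (e : i = j) x : cx_cast e x = 0 -> x = 0.
Proof. by case: j / e. Qed.

Lemma cx_d_cast i j (e : i = j) x :
  cx_d Z j (cx_cast e x) = cx_cast (congr1 (+%R^~ 1) e) (cx_d Z i x).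
Proof. by case: j / e. Qed.

Fact neg_degree (j : nat) : - (j.+1)%:Z + 1 = - j%:Z.
Proof. by rewrite intS opprD addrAC addNr add0r. Qed.

(* W_j = Z^(-j). *)
Definition cx_neg (j : nat) : fgMod R := Z (- j%:Z).
Definition cx_neg_d j : {linear cx_neg j.+1 -> cx_neg j} :=
  cx_cast (neg_degree j) \o cx_d Z (- (j.+1)%:Z).

Lemma cx_neg_d0 (x : Z (- 1)) : cx_neg_d 0 x = cx_d Z (- 1) x.
Proof. exact: cx_cast_id. Qed.

Lemma cx_neg_dd j x : cx_neg_d j (cx_neg_d j.+1 x) = 0.
Proof. by rewrite /= cx_d_cast cx_dd !linear0. Qed.

Lemma cx_neg_exact : neg_exact Z -> forall j x, cx_neg_d j x = 0 ->
  exists y, x = cx_neg_d j.+1 y.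
Proof.
move=> exZ j x /= dx; have e := neg_degree j.+1.
pose x' := cx_cast (esym e) x.
have xE : x = cx_cast e x' by rewrite cx_castK.
have [||y x'y] := exZ _ x'.
- by rewrite e oppr_lt0.
- move: dx; rewrite xE cx_d_cast.
  by move=> /cx_cast_eq0/cx_cast_eq0.
by exists y; rewrite xE x'y /= (Prop_irrelevance e (neg_degree j.+1)).
Qed.

End NatIndexing.

(** * Serre duality transported from S to Z *)

Section SerrePairing.
Variables (k : comNzRingType) (R : algType k) (E : lmodType k).
Variables (C : fgMod R -> Prop) (X : fgMod R) (T Z S : complex R).
Variables (f : chainMap T S)
  (phi : forall A, {linear Dual E (HomT (stalk X) A) -> HomT A S})
  (a : HomT Z T) (b : HomT T Z).
Implicit Types M N : fgMod R.
Hypotheses (subC : subcategory C)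
  (phi_bij : forall A, inHA A -> bijective (phi A))
  (phi_nat : forall A B (u : HomT A B) (xi : Dual E (HomT (stalk X) B)),
     inHA A -> inHA B ->
     phi A (dual_map (hcomp u) xi) = hcomp (phi B xi) u)
  (approx_f : approximation C f)
  (baK : hcomp b a = hid Z) (abK : hcomp a b = hid T)
  (dZ0 : forall y : Z 0, cx_d Z 0 y = 0).

(* [g : M -> Z^0], seen as a morphism P_M -> Z -> T -> S, corresponds to [eta]
   under Hom(P_M, S) = D Hom(P_X, P_M) = D Hom_R(X, M). *)
Definition serre (M : fgMod R) (g : HomR M (Z 0)) (eta : Dual E (HomR X M)) : Prop :=
  exists2 xi : Dual E (HomT (stalk X) (stalk M)),
    phi (stalk M) xi = hcomp (htpy_class f) (hcomp a (stalk_hom dZ0 g)) &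
    forall u, eta u = xi (stalk_pure u).

Definition pure_linear M : {linear HomR X M -> HomT (stalk X) (stalk M)} :=
  mk_linear (stalk_hom_linear (@stalk_d0 k R M)).

Lemma serre_linear M c g g' (eta eta' : Dual E (HomR X M)) :
  serre g eta -> serre g' eta' -> serre (c *: g + g') (c *: eta + eta').
Proof.
move=> [xi xiE etaE] [xi' xiE' etaE']; exists (c *: xi + xi').
  by rewrite linearP xiE xiE' stalk_hom_linear !linearP.
by move=> u /=; rewrite etaE etaE'.
Qed.

Lemma serre_total_l M g : exists eta : Dual E (HomR X M), serre g eta.
Proof.
have [psi psiK phiK] := phi_bij (stalk_inHA M).
set s := hcomp (htpy_class f) (hcomp a (stalk_hom dZ0 g)).
by exists (dual_map (pure_linear M) (psi s)), (psi s).
Qed.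

(** As M is in C, the morphism P_M -> S given by eta lifts through the approximation; b carries the
    lift to Z. *)
Lemma serre_total_r M (eta : Dual E (HomR X M)) : C M -> exists g, serre g eta.
Proof.
move=> CM.
have [||xi xiE] := @surj_lift _ _ _ _ (pure_linear M) eta.
- by move=> h; have [u <-] := stalk_hom_surj (@stalk_d0 k R M) h; exists u.
- by move=> u /stalk_pure_eq0 ->; rewrite linear0.
have [_ _ /(_ _ (stalk_inKminus subC CM))[lift liftK fK]] := approx_f.
have [g gE] := stalk_hom_surj dZ0 (hcomp b (lift (phi (stalk M) xi))).
exists g, xi; last by move=> u; rewrite -xiE.
by rewrite gE [hcomp a _]hcompA abK hcomp1 fK.
Qed.

Lemma serre_eq0 M g (eta : Dual E (HomR X M)) : C M -> serre g eta ->
  eta = 0 <-> exists v : {linear M -> Z (- 1)}, forall x, g x = cx_d Z (- 1) (v x).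
Proof.
move=> CM [xi xiE etaE]; have [psi phiK _] := phi_bij (stalk_inHA M).
have [_ _ /(_ _ (stalk_inKminus subC CM))/bij_inj f_inj] := approx_f.
rewrite -(stalk_hom_eq0 dZ0); split=> [eta0|g0].
  have xi0 : xi = 0.
    apply: linear_ext => h; have [u <-] := stalk_hom_surj (@stalk_d0 k R M) h.
    by rewrite -[stalk_hom _ _]/(stalk_pure u) -etaE eta0.
  move: xiE; rewrite xi0 linear0 -[LHS](linear0 (hcomp (htpy_class f))).
  move=> /f_inj e; rewrite -[LHS]hcomp1 -baK -hcompA -e.
  by rewrite linear0.
move: xiE; rewrite g0 !linear0 -[RHS](linear0 (phi (stalk M))) => /(can_inj phiK) xi0.
by apply: linear_ext => u; rewrite etaE xi0.
Qed.

Lemma serre_natural M N (u : {linear M -> N}) (g : {linear N -> Z 0})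
    (eta : Dual E (HomR X N)) (eta' : Dual E (HomR X M)) :
  serre g eta -> (forall w : {linear X -> M}, eta' w = eta (u \o w)) ->
  serre (g \o u : {linear _ -> _}) eta'.
Proof.
move=> [xi xiE etaE] eta'E; exists (dual_map (hcomp (stalk_pure u)) xi).
  rewrite phi_nat ?xiE; [|exact: stalk_inHA..].
  by rewrite -!hcompA hcomp_stalk_hom.
by move=> w; rewrite eta'E etaE /= hcomp_stalk_pure.
Qed.

End SerrePairing.

(** * The augmented resolution, Ext and stable Hom *)

Section Augmented.
Variables (k : comNzRingType) (R : algType k) (Y : fgMod R) (P : projRes Y).

(* Q_0 = Y and Q_(j+1) = P_j: the resolution together with its augmentation. *)
Definition aug_ob (j : nat) : fgMod R :=
  match j with 0 => Y | j'.+1 => P j' end.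

Definition aug_d (j : nat) : {linear aug_ob j.+1 -> aug_ob j} :=
  match j with 0 => res_aug P | j'.+1 => res_d P j' end.

Lemma aug_proj j : projective_obj (aug_ob j.+1).
Proof. exact: res_projective. Qed.

Lemma aug_exact j x : aug_d j x = 0 <-> exists y, x = aug_d j.+1 y.
Proof. by case: j x => [|j] x; [apply: res_exact0|apply: res_exactS]. Qed.

(** Replaces a projective varying with u by the fixed P_0, to which any map from a projective to Y
    lifts. *)
Lemma proj_factor_aug (X : fgMod R) (u : {linear X -> Y}) :
  proj_factor_mem u <-> exists w : {linear X -> P 0}, u =1 res_aug P \o w.
Proof.
split=> [/asboolP[Q projQ [g [h hg]]]|[w uw]].
  have [l lE] := projQ _ _ (res_aug P) h (@res_aug_surj _ _ _ P).
  by exists (l \o g) => x; rewrite -hg /= -lE.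
apply/asboolP; exists (P 0); first exact: res_projective.
by exists w, (res_aug P) => x; rewrite uw.
Qed.

Variables (n : nat) (W : nat -> fgMod R) (dW : forall j, {linear W j.+1 -> W j}).
Hypotheses (W_exact : forall j x, dW j x = 0 -> exists y, x = dW j.+1 y)
  (W_bound : is_zero_mod (W n.+3)).

(** [W n.+3] is zero, so by exactness [dW n.+1] is injective and can be cancelled. *)
Lemma weak_cocycleP (f : {linear P n.+1 -> W n.+2}) :
  weak_cocycle aug_d dW (f : {linear aug_ob n.+2 -> W n.+2}) <-> cocycle_mem f.
Proof.
split=> [wf|/asboolP cf x].
  apply/asboolP => x; have [y /= ->] := W_exact (wf x).
  by rewrite (W_bound y) linear0.
by rewrite /=; have /= -> := cf x; rewrite linear0.
Qed.

Lemma coboundaryP (f : {linear P n.+1 -> W n.+2}) :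
  null aug_d dW (f : {linear aug_ob n.+2 -> W n.+2}) <-> coboundary_mem f.
Proof.
split=> [[u [v fE]]|/asboolP[u fE]].
  apply/asboolP; exists u => x.
  by rewrite fE (W_bound (v x)) linear0 addr0.
by exists u, \0 => x; rewrite fE /= linear0 addr0.
Qed.

End Augmented.

Theorem theorem5p5 (k : comNzRingType) (R : algType k) (E : lmodType k)
    (n : nat) (C : fgMod R -> Prop) (X Y : fgMod R) (T Z : complex R)
    (P : projRes Y)
    (artin_R : artin_algebra R)
    (hull_E : injective_hull (quotMod (jacobson k)) E)
    (subcat_C : subcategory C)
    (orth_C : maximal_orthogonal n C)
    (CX : C X) (CY : C Y)
    (T_SC : is_SC E C X T)
    (Z_shape : injective_shape n C Z)
    (Z_iso : isoT Z T) :
  exists phi : {linear stableHom X Y -> Dual E (Ext P (Z (- n.+2%:Z)) n.+1)},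
    bijective phi.
Proof.
have [artin_k _ _ _] := artin_R.
suff [L L_bij] : exists L :
    {linear Ext P (Z (- n.+2%:Z)) n.+1 -> Dual E (stableHom X Y)}, bijective L.
  apply: reflexive_dualize L_bij => //; exact: stableHom_reflexive.
have [S [f [[[S_HA _] [phi [phi_bij phi_nat]]] approx_f]]] := T_SC.
have exZ : neg_exact Z.
  apply: isoT_neg_exact Z_iso _; have [_ qf _] := approx_f.
  by apply: quasi_iso_neg_exact qf _; case: S_HA.
have [a [b [baK abK]]] := Z_iso.
have dZ0 (y : Z 0) : cx_d Z 0 y = 0 by apply: (shape_gt0 Z_shape).
pose W := cx_neg Z; pose dW := cx_neg_d Z.
have W_exact := cx_neg_exact exZ; have W_dd := @cx_neg_dd _ _ Z.
have Q_proj := @aug_proj _ _ _ P; have Q_exact := @aug_exact _ _ _ P.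
have Q_surj := @res_aug_surj _ _ _ P.
(* The ladder lemmas reach one degree above the last injective, hence up to [W n.+2], which is
   X'. *)
have W_inj j : (j <= n.+1)%N -> injective_obj (W j).
  move=> jn; apply: (shape_inj Z_shape).
  by rewrite lerN2 lez_nat jn oppr_le0.
have W_bound : is_zero_mod (W n.+3).
  by apply: (shape_lt Z_shape); rewrite ltrN2 ltz_nat.
have C_P0 : C (P 0) := mo_projective orth_C (@res_projective _ _ _ P 0).
pose srr (M : fgMod R) := @serre k R E X T Z S f phi a dZ0 M.
pose lad := @ladder k R (aug_ob P) W (aug_d P) dW n.+2.
have nullP (M : fgMod R) g (eta : Dual E (HomR X M)) : C M -> srr M g eta ->
    eta = 0 <-> exists v : {linear M -> W 1}, forall x, g x = dW 0 (v x).
  move=> CM s; rewrite (serre_eq0 subcat_C phi_bij approx_f baK CM s).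
  by split=> -[v vE]; exists v => x; rewrite vE /dW cx_neg_d0.
pose Rel (x : Ext P (Z (- n.+2%:Z)) n.+1) (lam : Dual E (stableHom X Y)) :=
  exists c g, [/\ x = quot_pi _ c, lad (val c) g &
    srr Y g (dual_map (quot_pi (proj_factor X Y)) lam)].
(* By naturality along the augmentation, eta descends to stable Hom exactly when g admits the first
   step P_0 -> Z^(-1) of a ladder. *)
have to_aug g eta (eta' : Dual E (HomR X (P 0))) : srr Y g eta ->
    (forall w : {linear X -> P 0}, eta' w = eta (res_aug P \o w)) ->
    eta' = 0 <->
    exists f1 : {linear P 0 -> W 1}, forall x, dW 0 (f1 x) = g (res_aug P x).
  move=> s eta'E; have s' := serre_natural phi_nat s eta'E.
  rewrite (nullP _ _ _ C_P0 s').
  by split=> -[f1 f1E]; exists f1 => x; apply: (esym (f1E x)).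
have aug_lin (eta : Dual E (HomR X Y)) :
    linear (fun w : HomR X (P 0) => eta (res_aug P \o w)).
  move=> r w w'; rewrite -linearP; congr (eta _); apply: linear_ext => x /=.
  by rewrite linearD /hom_scale_fun linearZ.
apply: (@linear_relation_bij _ _ _ Rel).
- move=> r x x' lam lam' [c [g [-> lcg sg]]] [c' [g' [-> lcg' sg']]].
  exists (r *: c + c'), (r *: (g : HomR _ _) + g'); split.
  + by rewrite linearP.
  + exact: ladder_linear.
  + suff -> : dual_map (quot_pi (proj_factor X Y)) (r *: lam + lam') =
      r *: dual_map (quot_pi (proj_factor X Y)) lam +
      dual_map (quot_pi (proj_factor X Y)) lam' by exact: serre_linear.
    exact: linear_ext.
- move=> x; pose c := quot_repr x.
  have wc : weak_cocycle (aug_d P) dW (m := n.+2) (val c).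
    by apply: ((weak_cocycleP W_exact W_bound (val c)).2 (valP c)).
  have [g lcg] := ladder_total_l Q_exact W_dd W_inj (leqnn n.+2) wc.
  have [eta sg] : exists eta, srr Y g eta by apply: serre_total_l.
  have eta_aug : (mk_linear (aug_lin eta) : Dual E (HomR X (P 0))) = 0.
    apply/(to_aug _ _ _ sg) => //; exact: ladder_bottom lcg.
  have [|lam lamE] := @quot_lift _ _ _ (proj_factor X Y) eta.
    move=> u /(proj_factor_aug P)[w uw].
    have -> : u = res_aug P \o w by apply: linear_ext.
    exact: (congr1 (fun h : Dual E (HomR X (P 0)) => h w) eta_aug).
  exists lam, c, g; split=> //; first by rewrite quot_reprK.
  suff -> : dual_map (quot_pi (proj_factor X Y)) lam = eta by [].
  exact: linear_ext.
- move=> lam; pose eta := dual_map (quot_pi (proj_factor X Y)) lam.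
  have [g sg] : exists g, srr Y g eta by apply: serre_total_r CY; eassumption.
  have [f1 f1E] :
      exists f1 : {linear P 0 -> W 1}, forall x, dW 0 (f1 x) = g (res_aug P x).
    apply/(to_aug _ _ (mk_linear (aug_lin eta)) sg) => //; apply: linear_ext => w /=.
    suff -> : quot_pi (proj_factor X Y) (res_aug P \o w) = 0 by rewrite linear0.
    by apply/quot_pi_eq0/proj_factor_aug; exists w.
  have [h wh hg] := ladder_total_r Q_proj Q_exact W_exact n.+1 f1E.
  have ch := (weak_cocycleP W_exact W_bound h).1 wh.
  pose hc : subMod (Submodule (@cocycle_closed k R Y P (Z (- n.+2%:Z)) n.+1)) :=
    exist _ h ch.
  by exists (quot_pi _ hc), hc, g.
(* A coboundary at the top makes g null at the bottom, which for Y in C means that its functional is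
   0. *)
- move=> lam [c [g [c0 lcg sg]]].
  have nc : null (aug_d P) dW (m := n.+2) (val c).
    by apply/(coboundaryP dW W_bound); exact: ((quot_pi_eq0 _ c).1 (esym c0)).
  have := ladder_null_l Q_surj Q_exact W_dd W_inj (leqnn n.+2) lcg nc.
  move=> /(nullP _ _ _ CY sg) eta0.
  apply: linear_ext => v; rewrite -[v]quot_reprK.
  exact: (congr1 (fun h : Dual E (HomR X Y) => h (quot_repr v)) eta0).
move=> x [c [g [-> lcg sg]]].
have ng : null (aug_d P) dW (m := 0) g.
  apply/(nullP _ _ _ CY sg); exact: linear_ext.
have nc := ladder_null_r Q_proj Q_exact W_exact lcg ng.
by apply/quot_pi_eq0; apply/(coboundaryP dW W_bound).
Qed.
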